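(* Let $P_0$ be a distribution on $\mathbb{R}^d$. Let $\mathcal{D}_{\mathrm{null}}$ be a sample of $n_0$ i.i.d. points from $P_0$, split into $\mathcal{D}_{\mathrm{train}}$ and $\mathcal{D}_{\mathrm{cal}}=(X_1,\dots,X_n)$ with $1<n<n_0$, and let $\mathcal{D}_{\mathrm{test}}=(X_{n+1},\dots,X_{n+m})$ be independent points in $\mathbb{R}^d$, independent of $\mathcal{D}_{\mathrm{null}}$, each either distributed as $P_0$ or not; let $\mathcal{H}_0=\{i\in\{1,\dots,m\}:X_{n+i}\sim P_0\}$. Let $S_i=g(X_i)$, $i\in\{1,\dots,n+m\}$, where the score function $g=g(\cdot;\mathcal{D}_{\mathrm{train}},(X_1,\dots,X_{n+m}))$ is invariant under permutations of $(X_1,\dots,X_{n+m})$, and assume the scores have almost surely no ties. Let $p_i=\frac1{n+1}\big(1+\sum_{j=1}^n\mathbf{1}\{S_j\geq S_{n+i}\}\big)$, $i\in\{1,\dots,m\}$, and $\mathcal{R}(t)=\{i\in\{1,\dots,m\}:p_i\leq t\}$. Let $\delta\in(0,1)$ and let $\hat m_0$ be any random variable such that $$\hat m_0\geq\max\Big\{r\in\{1,\dots,m\}:\inf_{t\in(0,1)}\frac{\sum_{i=1}^m\mathbf{1}\{p_i>t\}+r\lambda^{\mathrm{DKW}}_{\delta,n,r}}{1-I_n(t)}\geq r\Big\},$$ the maximum being taken equal to $m$ if the set is empty. Then with probability at least $1-\delta$, for all $t\in(0,1)$, $$\mathrm{FDP}(\mathcal{R}(t))\leq\frac{\hat m_0I_n(t)+\hat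 m_0\lambda^{\mathrm{DKW}}_{\delta,n,\hat m_0}}{1\vee|\mathcal{R}(t)|}.$$
   Context: $\mathrm{FDP}(R)=|R\cap\mathcal{H}_0|/(|R|\vee1)$ for $R\subset\{1,\dots,m\}$. $I_n(t)=\lfloor(n+1)t\rfloor/(n+1)$. For integers $n,r\geq1$ and $\delta\in(0,1)$, with $\tau_{n,r}=nr/(n+r)$, $\lambda^{\mathrm{DKW}}_{\delta,n,r}=\Psi^{(k)}(1)$ for a fixed integer $k\geq1$ ($\Psi$ iterated $k$ times), where $\Psi(x)=1\wedge\Big(\frac{\log(1/\delta)+\log(1+\sqrt{2\pi}\,2\tau_{n,r}x/(n+r)^{1/2})}{2\tau_{n,r}}\Big)^{1/2}$. *)

(* Defs.v *)
From HB Require Import structures.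
From mathcomp Require Import all_boot all_order all_algebra.
From mathcomp Require Import all_classical all_reals all_analysis.
Set Implicit Arguments. Unset Strict Implicit. Unset Printing Implicit Defensive.
Import Order.TTheory GRing.Theory Num.Theory.
Local Open Scope classical_set_scope.
Local Open Scope ring_scope.

(* R^d, with the product (Borel) sigma-algebra of MathComp-Analysis tuples. *)
Definition Rd (R : realType) (d : nat) := d.-tuple R.

Definition mutual_indep {dT dE : measure_display} {T : measurableType dT}
  {E : measurableType dE} {R : realType} (P : probability T R) {I : finType}
  (X : I -> T -> E) : Prop :=
  forall B : I -> set E, (forall i, measurable (B i)) ->
    P [set w | forall i, B i (X i w)] = (\prod_(i : I) P (X i @^-1` B i))%E.

Definition has_law {dT dE : measure_display} {T : measurableType dT}
  {E : measurableType dE} {R : realType} (P : probability T R)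
  (X : T -> E) (P0 : probability E R) : Prop :=
  forall B : set E, measurable B -> P (X @^-1` B) = P0 B.

Definition FDP {R : realType} {m : nat} (H0 Rej : {set 'I_m}) : R :=
  (#|Rej :&: H0|)%:R / (maxn #|Rej| 1)%:R.

Definition In_ {R : realType} (n : nat) (t : R) : R :=
  (Num.floor (n.+1%:R * t))%:~R / n.+1%:R.

Definition tau {R : realType} (n r : nat) : R := (n * r)%:R / (n + r)%:R.

Definition Psi {R : realType} (delta : R) (n r : nat) (x : R) : R :=
  Order.min 1
    (Num.sqrt ((ln (delta^-1)
                + ln (1 + Num.sqrt (2 * pi) * (2 * tau n r * x) / Num.sqrt (n + r)%:R))
               / (2 * tau n r))).

Definition lambdaDKW {R : realType} (k : nat) (delta : R) (n r : nat) : R :=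
  iter k (Psi delta n r) 1.

Definition conf_pval {R : realType} {n m : nat} (Scal : 'I_n -> R) (Stest : 'I_m -> R)
  (i : 'I_m) : R :=
  (1 + #|[set j : 'I_n | Stest i <= Scal j]%SET|)%:R / n.+1%:R.

Definition rej {R : realType} {m : nat} (p : 'I_m -> R) (t : R) : {set 'I_m} :=
  [set i | p i <= t]%SET.

Definition m0_cond {R : realType} (k : nat) (delta : R) (n : nat) {m : nat}
  (p : 'I_m -> R) (r : nat) : bool :=
  (0 < r)%N &&
  (r%:R <= inf [set ((#|[set i | t < p i]%SET|)%:R + r%:R * lambdaDKW k delta n r)
                      / (1 - In_ n t) | t in `]0, 1[%classic]).

Definition m0_bound {R : realType} (k : nat) (delta : R) (n : nat) {m : nat}
  (p : 'I_m -> R) : nat :=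
  if [exists r : 'I_m.+1, m0_cond k delta n p r]
  then \max_(r < m.+1 | m0_cond k delta n p r) r
  else m.

(* Main.v *)
Require Import Defs.
From HB Require Import structures.
From mathcomp Require Import all_boot all_order all_algebra.
From mathcomp Require Import all_classical all_reals all_analysis.
From mathcomp Require Import perm.
From mathcomp Require Import measurable_realfun zify ring lra.
Import Order.TTheory GRing.Theory Num.Theory.
Import numFieldNormedType.Exports.
Local Open Scope classical_set_scope.
Local Open Scope ring_scope.

Set Implicit Arguments.
Unset Strict Implicit.
Unset Printing Implicit Defensive.

(** Permutation invariance of the score makes the scores of the calibration and
    null test points exchangeable, so without ties their ranks are uniform: it
    suffices to count the permutations for which the empirical distribution of
    the null p-values exceeds its level by [l].  Replacing the ranks by independent
    uniform points on a fine grid, the excess splits as (test points against the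
    grid) + (grid against calibration points).  Each part obeys the one-sided
    Dvoretzky-Kiefer-Wolfowitz inequality with constant 1, proved by a change of
    measure: an atom is added below the grid, and the likelihood ratio at the last
    crossing is large uniformly in its location.  Convolving the two Gaussian tails
    gives [dkw_bound], which is at most [delta] at every iterate of [Psi].  On the
    resulting event [#|H0|] satisfies [m0_cond], and [r * lambdaDKW r] is
    nondecreasing in [r]. *)

(** * An exponential tilt inequality *)

(** A union bound over levels would spoil the constant 1, so the crossing event is split by its last
    crossing level. That event is decided by the points at or above the level, so those below it can
    be merged into one atom, and a single atom-augmented law serves all levels at once. Normalising
    this law costs [2 * e + 2 / 3 * e ^+ 2] per point in the exponent, while the likelihood ratio
    gains at least [2 * e + 8 / 3 * e ^+ 2]; the difference is [2 * e ^+ 2]. The two errors share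
    the budget [l] as [x] and [l - x]. A fixed split would lose the sharp exponent, so [x] follows
    the calibration sample: this leads to a layered sum and, in the limit, to a Stieltjes integral,
    whose exponent is governed by [n * r / (n + r)] and whose Gaussian mass gives the
    [sqrt (2 * pi)] term. The grid turns every probability into a count; the maps with ties are a
    share of at most [N ^ 2 / G], which vanishes in the limit. *)

Lemma is_derive_ge0_le (R : realType) (f df : R -> R) (a b : R) : a <= b ->
  (forall x, a <= x <= b -> is_derive x 1 f (df x)) ->
  (forall x, a < x < b -> 0 <= df x) -> f a <= f b.
Proof.
move=> ab fdf df0; have [<-//|neq] := eqVneq a b.
have {neq}ab' : a < b by rewrite lt_neqAle neq.
have cf : {within `[a, b], continuous f}.
  apply: derivable_within_continuous => x; rewrite in_itv/= => xab.
  by have := fdf x xab; move=> [].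
have [x xab fE] := MVT ab' (fun x (xab : x \in `]a, b[) =>
  fdf x (subset_itv_oo_cc xab)) cf.
rewrite -subr_ge0 fE mulr_ge0 ?subr_ge0//; apply: df0.
by move: xab; rewrite in_itv.
Qed.

Section tilt_inequality.
Variable R : realType.
Implicit Types e t : R.

Let E e : R := expR (2 * e + 2 / 3 * e ^+ 2).

Let is_derive_E e : is_derive e 1 E ((2 + 4 / 3 * e) * E e).
Proof.
have h : is_derive e 1 (fun e : R => 2 * e + 2 / 3 * e ^+ 2) (2 + 4 / 3 * e).
  by apply: is_derive_eq; rewrite /GRing.scale/=; field.
apply: (@is_derive_eq _ _ _ _ _ _ _ _
  (@is_derive1_comp _ expR _ e _ _ (is_derive_expR _) h)).
by rewrite mulrC.
Qed.

Let E_ge e : 0 <= e -> 1 + 2 * e <= E e.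
Proof. by move=> e0; apply: le_trans (expR_ge1Dx _); nra. Qed.

(** Gives the sign of the first discriminant factor below. After division by [E], the difference of
    the two sides has derivative [4 * (1 - G x * (1 + 2 * x + 2 / 3 * x ^+ 2))], nonnegative by
    [1 + u <= expR u]. Past [3 / 4] the left side is negative. *)
Let E_le e : 0 <= e -> E e * (3 - 4 * e) <= 3 + 2 * e.
Proof.
move=> e0; have [e34|e34] := ltP (3 / 4) e.
  by have := E_ge e0; nra.
pose G x : R := expR (- (2 * x + 2 / 3 * x ^+ 2)).
pose F x : R := G x * (3 + 2 * x) + 4 * x - 3.
have dG (x : R) : is_derive x 1 G (- (2 + 4 / 3 * x) * G x).
  have h : is_derive x 1 (fun e : R => - (2 * e + 2 / 3 * e ^+ 2)) (- (2 + 4 / 3 * x)).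
    by apply: is_derive_eq; rewrite /GRing.scale/=; field.
  apply: (@is_derive_eq _ _ _ _ _ _ _ _
    (@is_derive1_comp _ expR _ x _ _ (is_derive_expR _) h)).
  by rewrite mulrC.
have dF (x : R) : is_derive x 1 F (- (2 + 4 / 3 * x) * G x * (3 + 2 * x) + G x * 2 + 4).
  have h := dG x.
  rewrite /F; apply: is_derive_eq; rewrite /GRing.scale/=; lra.
have : F 0 <= F e.
  apply: (@is_derive_ge0_le _ F _ 0 e e0 (fun x _ => dF x)) => x /andP[x0 xe].
  set g := G x.
  have -> : - (2 + 4 / 3 * x) * g * (3 + 2 * x) + g * 2 + 4 =
    4 * (1 - g * (1 + 2 * x + 2/3 * x ^+ 2)) by field.
  rewrite pmulr_rge0// subr_ge0.
  have := expR_ge1Dx (2 * x + 2 / 3 * x ^+ 2).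
  rewrite /g /G expRN => h.
  rewrite mulrC ler_pdivrMr ?expR_gt0// mul1r; apply: le_trans h; lra.
have -> : F 0 = 0 by rewrite /F /G !(mulr0, expr0n, addr0, oppr0) expR0/=; ring.
rewrite /F /G expRN -/(E e) => h.
have E0 : 0 < E e by exact: expR_gt0.
rewrite -subr_ge0.
have -> : 3 + 2 * e - E e * (3 - 4 * e) = E e * ((E e)^-1 * (3 + 2 * e) + 4 * e - 3).
  by field; rewrite gt_eqF.
by rewrite mulr_ge0// ltW.
Qed.

(* The discriminant in t of the quadratic below is the product
   (E (3 - 4 e) - (3 + 2 e)) (E (3 + 8 e + 8 e^2) - (3 + 8 e + 4 e^2) (1 + 2 e)). *)
Let tilt_quadratic_ge0 e t : 0 < e ->
  0 <= E e * ((3 + 2 * e) * t ^+ 2 + (4 * e ^+ 2 - 2 * e - 3) * t + 2 * e ^+ 3 - e ^+ 2)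
       + (1 - t) * (3 * t + 8 * e * t + 4 * e ^+ 2).
Proof.
move=> e0; have := E_ge (ltW e0); have := E_le (ltW e0).
move: (E e) => X Xle Xge.
pose a := X * (3 + 2 * e) - (3 + 8 * e).
pose b := X * (4 * e ^+ 2 - 2 * e - 3) + 3 + 8 * e - 4 * e ^+ 2.
pose c := e ^+ 2 * (X * (2 * e - 1) + 4).
have a0 : 0 < a.
  have e20 : 0 < e ^+ 2 by exact: exprn_gt0.
  rewrite /a; nra.
have dE : 4 * a * c - b ^+ 2 = (3 + 2 * e - X * (3 - 4 * e)) *
    (X * (3 + 8 * e + 8 * e ^+ 2) - (3 + 8 * e + 4 * e ^+ 2) * (1 + 2 * e)).
  by rewrite /a /b /c; ring.
have d0 : 0 <= 4 * a * c - b ^+ 2.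
  rewrite dE mulr_ge0 ?subr_ge0//.
  have e20 : 0 < e ^+ 2 by exact: exprn_gt0.
  rewrite mulrC; apply: ler_pM => //; nra.
have -> : X * ((3 + 2 * e) * t ^+ 2 + (4 * e ^+ 2 - 2 * e - 3) * t + 2 * e ^+ 3 - e ^+ 2)
    + (1 - t) * (3 * t + 8 * e * t + 4 * e ^+ 2) =
  (4 * a)^-1 * ((2 * a * t + b) ^+ 2 + (4 * a * c - b ^+ 2)).
  have : a != 0 by rewrite gt_eqF.
  by rewrite /a /b /c => ?; field.
by rewrite mulr_ge0 ?(addr_ge0 (sqr_ge0 _))// invr_ge0 mulr_ge0// ltW.
Qed.

(* Tilting the law of one point by an atom of mass proportional to
   [expR (2 * e + 2 / 3 * e ^+ 2) - 1] makes the tail exponent uniform in [t]. *)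
Lemma tilt_ln_ge e t : 0 <= e -> 0 < t ->
  2 * e + 8 / 3 * e ^+ 2 <=
  (t + e) * ln (1 + (expR (2 * e + 2 / 3 * e ^+ 2) - 1) / t).
Proof.
move=> e0 t0; rewrite -/(E e).
have E1 (x : R) : 0 <= x -> 1 <= E x by move=> x0; apply: le_trans (E_ge x0); lra.
have tE (x : R) : 0 <= x -> 0 < t + E x - 1 by move=> x0; have := E1 _ x0; lra.
(* Dividing the claim by [t + x] isolates the logarithm and turns it into [Y 0 <= Y e], with
   [Y 0 = ln t]. The derivative of [Y] is the quadratic above up to a positive factor. *)
pose Y x := ln (t + E x - 1) - (2 * x + 8 / 3 * x ^+ 2) / (t + x).
have dY (x : R) : 0 <= x -> is_derive x 1 Y ((2 + 4 / 3 * x) * E x / (t + E x - 1) -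
   ((2 + 16 / 3 * x) * (t + x) - (2 * x + 8 / 3 * x ^+ 2)) / (t + x) ^+ 2).
  move=> x0; have tx : 0 < t + x by lra.
  have dE := is_derive_E x.
  have dg : is_derive x 1 (fun x : R => t + E x - 1) ((2 + 4 / 3 * x) * E x).
    apply: is_derive_eq; rewrite ?oppr0. lra.
  have dl := @is_derive1_comp _ (@ln R) (fun x : R => t + E x - 1) x _ _ (is_derive1_ln (tE _ x0)) dg.
  have txn : t + x != 0 by rewrite gt_eqF.
  have dv : is_derive x 1 (fun x : R => (t + x)^-1) (- (t + x) ^- 2 * 1).
    have h : is_derive x 1 (fun x : R => t + x) (1 : R).
      by apply: is_derive_eq; lra.
    exact: is_deriveV txn h.
  rewrite /Y; apply: is_derive_eq.
  rewrite /GRing.scale/=.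
  by field; rewrite txn gt_eqF ?tE.
have : Y 0 <= Y e.
  apply: (is_derive_ge0_le e0 (fun x xe => dY x (proj1 (andP xe)))) => x /andP[x0 _].
  have tx : 0 < t + x by lra.
  have := tilt_quadratic_ge0 t x0; have := tE _ (ltW x0).
  move: (E x) => X X0 quad.
  have -> : (2 + 4 / 3 * x) * X / (t + X - 1) -
   ((2 + 16 / 3 * x) * (t + x) - (2 * x + 8 / 3 * x ^+ 2)) / (t + x) ^+ 2 =
   2 / 3 * ((t + X - 1)^-1 * (t + x) ^- 2 * (X *
     ((3 + 2 * x) * t ^+ 2 + (4 * x ^+ 2 - 2 * x - 3) * t + 2 * x ^+ 3 - x ^+ 2)
       + (1 - t) * (3 * t + 8 * x * t + 4 * x ^+ 2))).
    by field; rewrite !gt_eqF.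
  by rewrite !mulr_ge0 ?invr_ge0 ?exprn_ge0// ltW.
have -> : Y 0 = ln t.
  rewrite /Y /E !(mulr0, expr0n, addr0) expR0/= mul0r subr0; congr ln; ring.
have -> : 1 + (E e - 1) / t = (t + E e - 1) / t by field; rewrite gt_eqF.
rewrite ln_div ?posrE ?tE// /Y => h.
have te : 0 < t + e by lra.
rewrite [leRHS]mulrC -ler_pdivrMr//; lra.
Qed.

End tilt_inequality.

(** * The one-sample inequality on a grid *)

Lemma big_option (R : nmodType) (X : finType) (F : option X -> R) :
  \sum_y F y = F None + \sum_x F (Some x).
Proof.
rewrite (bigD1 None)//=; congr (_ + _).
rewrite (reindex_omap Some id)/=; last by case.
by apply: eq_bigl => x; rewrite eqxx.
Qed.

(** Lets two product weights on different spaces be compared through their common image under a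
    coordinatewise map, here [clip]. *)
Lemma sum_ffun_pushforward (R : comPzSemiRingType) (I X Y : finType) (k : X -> Y)
    (m : X -> R) (g : {ffun I -> Y} -> R) :
  \sum_(W : {ffun I -> X}) g [ffun i => k (W i)] * \prod_i m (W i) =
  \sum_(c : {ffun I -> Y}) g c * \prod_i \sum_(x | k x == c i) m x.
Proof.
rewrite (partition_big (fun W : {ffun I -> X} => [ffun i => k (W i)]) xpredT)//=.
apply: eq_bigr => c _.
rewrite (bigA_distr_big_dep (fun i x => k x == c i) (fun i x => m x)) big_distrr/=.
apply: eq_big => [W|W /eqP<-//].
apply/eqP/forallP => [<- i|h]; first by rewrite unfold_in ffunE.
by apply/ffunP => i; rewrite ffunE; apply/eqP; have := h i; rewrite unfold_in.
Qed.

Section grid_DKW.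
Variables (R : realType) (I : finType) (G : nat) (e : R).
Hypothesis e0 : 0 <= e.

Let r := #|I|.
Let q : R := expR (2 * e + 2 / 3 * e ^+ 2) - 1.
(** [None] is the added atom; it lies below every level, including level 0. *)
Let below (a : nat) (y : option 'I_G) := if y is Some x then (x < a)%N else true.
Let cnt (a : nat) (c : {ffun I -> option 'I_G}) := #|[set i | below a (c i)]%SET|.
Let hit (a : nat) (c : {ffun I -> option 'I_G}) : bool :=
  r%:R * (a%:R / G%:R + e) < (cnt a c)%:R.
Let last_hit (a : nat) (c : {ffun I -> option 'I_G}) : bool :=
  hit a c && [forall b : 'I_G.+1, (a < b)%N ==> ~~ hit b c].
Let clip (a : nat) (y : option 'I_G) : option 'I_G :=
  if below a y then None else y.
Let w (y : option 'I_G) : R := if y is Some _ then 1 else q * G%:R.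

Let q0 : 0 <= q.
Proof. by rewrite subr_ge0 -[leLHS]expR0 ler_expR addr_ge0 ?mulr_ge0 ?exprn_ge0. Qed.

Let w0 y : 0 <= w y.
Proof. by case: y => [x|]//=; rewrite mulr_ge0. Qed.

Let cnt_clip a b (c : {ffun I -> option 'I_G}) : (a <= b)%N ->
  cnt b [ffun i => clip a (c i)] = cnt b c.
Proof.
move=> ab; rewrite /cnt; congr #|pred_of_set _|; apply/setP => i; rewrite !inE ffunE /clip.
by case: (c i) => [x|]//=; case: ifP => //= xa; rewrite (leq_trans xa).
Qed.

(** The last crossing at [a] involves only the counts at levels [b >= a], and these do not separate
    the points below [a] from the atom. *)
Let last_hit_clip a (c : {ffun I -> option 'I_G}) :
  last_hit a [ffun i => clip a (c i)] = last_hit a c.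
Proof.
rewrite /last_hit /hit cnt_clip//; congr andb; apply: eq_forallb => b.
by case: ltnP => //= ab; rewrite cnt_clip// ltnW.
Qed.

Let tilt (a : nat) (x : 'I_G) : R := if (x < a)%N then 1 + q * G%:R / a%:R else 1.

(** The [a] points below the level carry [1 + q * G / a] each, in total [a + q * G]: the mass of [a]
    unit points and the atom, once these are merged. *)
Let tilt_mass a : (0 < a <= G)%N -> forall y,
  \sum_(x : 'I_G | clip a (Some x) == y) tilt a x =
  \sum_(y' : option 'I_G | clip a y' == y) w y'.
Proof.
move=> /andP[a0 aG] y.
have -> : \sum_(y' : option 'I_G | clip a y' == y) w y' =
    (if None == y then q * G%:R else 0) + \sum_(x : 'I_G | clip a (Some x) == y) 1.
  by rewrite big_mkcond big_option /= [in RHS]big_mkcond.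
case: y => [y|] /=.
  rewrite add0r; apply: eq_bigr => x.
  by rewrite /clip /tilt /=; case: (ltnP x a).
have cl (x : 'I_G) : (clip a (Some x) == None) = (x < a)%N.
  by rewrite /clip /=; case: ltnP.
rewrite (eq_bigl _ _ cl) [in RHS](eq_bigl _ _ cl).
have sE (z : R) : \sum_(x < G | (x < a)%N) z = z * a%:R.
  by rewrite -(big_ord_widen G (fun=> z) aG) sumr_const card_ord mulr_natr.
rewrite (eq_bigr (fun=> 1 + q * G%:R / a%:R)); last by move=> x xa; rewrite /tilt xa.
rewrite !sE mul1r mulrDl mul1r addrC; congr (_ + _).
by rewrite mulfVK// pnatr_eq0 -lt0n.
Qed.

(** The weight [w] on the right does not depend on [a], so these identities can be summed over
    [a]. *)
Let sum_last_hit_tilt a : (0 < a <= G)%N ->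
  \sum_(W : {ffun I -> 'I_G}) (last_hit a [ffun i => Some (W i)])%:R * \prod_i tilt a (W i) =
  \sum_(c : {ffun I -> option 'I_G}) (last_hit a c)%:R * \prod_i w (c i).
Proof.
move=> aG.
transitivity (\sum_(c : {ffun I -> option 'I_G}) (last_hit a c)%:R *
    \prod_i \sum_(x : 'I_G | clip a (Some x) == c i) tilt a x).
  rewrite -sum_ffun_pushforward; apply: eq_bigr => W _; rewrite -last_hit_clip.
  by congr ((last_hit a _)%:R * _); apply/ffunP => i; rewrite !ffunE.
transitivity (\sum_(c : {ffun I -> option 'I_G}) (last_hit a c)%:R *
    \prod_i \sum_(y : option 'I_G | clip a y == c i) w y).
  by apply: eq_bigr => c _; congr (_ * _); apply: eq_bigr => i _; exact: tilt_mass.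
rewrite -sum_ffun_pushforward; apply: eq_bigr => W _; rewrite -[in RHS]last_hit_clip.
by congr ((last_hit a _)%:R * _).
Qed.

Let prod_tilt a (W : {ffun I -> 'I_G}) :
  \prod_i tilt a (W i) = (1 + q * G%:R / a%:R) ^+ cnt a [ffun i => Some (W i)].
Proof.
rewrite (eq_bigr (fun i => if i \in [set i | (W i < a)%N]%SET then 1 + q * G%:R / a%:R else 1)); last first.
  by move=> i _; rewrite inE.
rewrite -big_mkcond/= prodr_const; congr (_ ^+ _).
by rewrite /cnt; apply: eq_card => i; rewrite !inE ffunE.
Qed.

Let K : R := expR (- (r%:R * (2 * e + 8 / 3 * e ^+ 2))).

(** A hit puts more than [r * (t + e)] points below the level [t = a / G], each contributing a
    factor [1 + q / t]; [tilt_ln_ge] bounds the product below by [K^-1], uniformly in [a]. *)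
Let tilt_large a (W : {ffun I -> 'I_G}) : (0 < a <= G)%N ->
  hit a [ffun i => Some (W i)] -> 1 <= K * \prod_i tilt a (W i).
Proof.
move=> /andP[a0 aG]; rewrite prod_tilt /hit; set c := cnt _ _ => hc.
have G0 : (0 < G)%N by exact: leq_trans aG.
have aR : 0 < (a%:R : R) by rewrite ltr0n.
have GR : 0 < (G%:R : R) by rewrite ltr0n.
have t0 : 0 < (a%:R / G%:R : R) by rewrite divr_gt0.
have := tilt_ln_ge e0 t0; rewrite -/q.
have -> : q / (a%:R / G%:R) = q * G%:R / a%:R by field; rewrite !gt_eqF.
set z := 1 + q * _ / _; set t := a%:R / _ => h.
have z1 : 1 <= z by rewrite lerDl divr_ge0 ?mulr_ge0// ltW.
have l0 : 0 <= ln z by exact: ln_ge0.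
rewrite /K -[z](@lnK R) ?posrE ?(lt_le_trans _ z1)//.
rewrite -expRM_natl -expRD -[leLHS]expR0 ler_expR addrC subr_ge0.
rewrite (le_trans (ler_wpM2l (ler0n _ _) h))// mulrA ler_wpM2r// ltW//.
Qed.

Lemma grid_DKW :
  #|[set W : {ffun I -> 'I_G} | [exists a : 'I_G.+1,
       #|I|%:R * (a%:R / G%:R + e) < (#|[set i | (W i < a)%N]%SET|)%:R]]%SET|%:R
  <= G%:R ^+ #|I| * expR (- (2 * #|I|%:R * e ^+ 2)).
Proof.
set A := [set _ | _]%SET.
have hitE a (W : {ffun I -> 'I_G}) : hit a [ffun i => Some (W i)] =
    (#|I|%:R * (a%:R / G%:R + e) < (#|[set i | (W i < a)%N]%SET|)%:R).
  rewrite /hit /cnt; congr (_ < _%:R); congr #|pred_of_set _|.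
  by apply/setP => i; rewrite !inE ffunE.
(* Level 0 is never crossed by genuine grid points, so the division by [a] in [tilt] is harmless. *)
have hit_gt0 a (c : {ffun I -> 'I_G}) : hit a [ffun i => Some (c i)] -> (0 < a)%N.
  rewrite hitE; case: a => // h; exfalso; move: h.
  have -> : [set i | (c i < 0)%N]%SET = finset.set0 by apply/setP => i; rewrite !inE.
  by rewrite cards0 mul0r add0r ltNge mulr_ge0.
have step1 : #|A|%:R <= \sum_(W : {ffun I -> 'I_G}) \sum_(a < G.+1 | (0 < a)%N)
    (last_hit a [ffun i => Some (W i)])%:R :> R.
  rewrite -sum1_card natr_sum big_mkcond; apply: ler_sum => W _.
  have sge0 : 0 <= \sum_(a < G.+1 | (0 < a)%N) (last_hit a [ffun i => Some (W i)])%:R :> R.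
    by apply: sumr_ge0.
  case: ifPn => // /[!inE] /existsP[a0 ha0].
  pose P (a : 'I_G.+1) := hit a [ffun i => Some (W i)].
  have Pa0 : P a0 by rewrite /P hitE.
  case: (@arg_maxnP _ a0 P val Pa0) => a Pa amax.
  rewrite (bigD1 a) /=; last exact: hit_gt0 Pa.
  have -> : last_hit a [ffun i => Some (W i)].
    rewrite /last_hit -/(P a) Pa/=; apply/forallP => b; apply/implyP => ab.
    by apply/negP => /amax; apply/negP; rewrite /= -ltnNge.
  by rewrite lerDl sumr_ge0.
have step2 : #|A|%:R <= K * \sum_(c : {ffun I -> option 'I_G})
    (\sum_(a < G.+1 | (0 < a)%N) (last_hit a c)%:R) * \prod_i w (c i).
  apply: le_trans step1 _; rewrite exchange_big/= mulr_sumr.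
  under [leRHS]eq_bigr do rewrite mulr_suml mulr_sumr.
  rewrite [leRHS]exchange_big/=; apply: ler_sum => a a0.
  have aG : (0 < a <= G)%N by rewrite a0 -ltnS ltn_ord.
  rewrite -mulr_sumr -sum_last_hit_tilt// mulr_sumr; apply: ler_sum => W _.
  case: (boolP (last_hit _ _)) => [/andP[hW _]|_]; last by rewrite mul0r mulr0.
  by rewrite mul1r tilt_large.
apply: le_trans step2 _.
(* A configuration has at most one last crossing, so the inner sum is at most 1 and only the total
   mass of [w] remains. *)
apply: (@le_trans _ _ (K * \sum_(c : {ffun I -> option 'I_G}) \prod_i w (c i))).
  rewrite ler_wpM2l ?expR_ge0//; apply: ler_sum => c _.
  rewrite ler_piMl ?prodr_ge0// -natr_sum lern1.
  have [[a /andP[a0 la]]|no] := pselect (exists a : 'I_G.+1, (0 < a)%N && last_hit a c); last first.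
    rewrite big1// => a a0; case: (boolP (last_hit a c)) => // la.
    by exfalso; apply: no; exists a; rewrite a0.
  rewrite (bigD1 a)//= big1 ?addn0 ?leq_b1// => b /andP[b0 ba].
  case: (boolP (last_hit b c)) => // /andP[hb /forallP lb].
  case/andP: la => ha /forallP la; exfalso.
  move: ba; rewrite -val_eqE neq_ltn => /orP[ba|ab].
    by have := lb a; rewrite ba ha.
  by have := la b; rewrite ab hb.
have -> : \sum_(c : {ffun I -> option 'I_G}) \prod_i w (c i) = (G%:R * (1 + q)) ^+ r.
  rewrite -(bigA_distr_bigA (fun (i : I) y => w y)) prodr_const big_option/=.
  by rewrite sumr_const card_ord addrC mulrDr mulr1 [q * _]mulrC.
rewrite exprMn mulrCA -/r ler_wpM2l ?exprn_ge0//.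
(* The total mass contributes the exponent [2 * e + 2 / 3 * e ^+ 2] per point and [K] removes
   [2 * e + 8 / 3 * e ^+ 2]. *)
rewrite /q addrC subrK /K -expRM_natl -expRD ler_expR -/r.
have : 0 <= (r%:R : R) by []; nra.
Qed.

End grid_DKW.

(** * Convolution of two Gaussian tails *)

Section gaussian_convolution.
Variable R : realType.
Implicit Types (m s x : R).

Let cdf m s x : R := \int[lebesgue_measure]_(t in `]-oo, x]) normal_pdf m s t.

Let is_derive_cdf m s x : s != 0 -> is_derive x 1 (cdf m s) (normal_pdf m s x).
Proof.
move=> s0.
have int : lebesgue_measure.-integrable `]-oo, x + 1] (EFin \o normal_pdf m s).
  by apply: integrableS (integrable_normal_pdf m s).
have xx1 : x < x + 1 by rewrite ltrDl.
have cpdf : {for x, continuous (normal_pdf m s)} by exact: continuous_normal_pdf.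
have /(_ _ cpdf)[|dF FE] := @continuous_FTC1 R (normal_pdf m s) -oo%O x (x + 1) xx1 int.
  by rewrite ltNyr.
by apply: DeriveDef => //; rewrite -derive1E FE.
Qed.

Let cdf_ge0 m s x : 0 <= cdf m s x.
Proof. by apply: Rintegral_ge0 => t _; exact: normal_pdf_ge0. Qed.

Let cdf_le1 m s x : cdf m s x <= 1.
Proof.
rewrite /cdf /Rintegral -lee_fin fineK; last first.
  apply: integrable_fin_num => //.
  by apply: integrableS (integrable_normal_pdf m s).
rewrite -(integral_normal_pdf m s); apply: ge0_subset_integral => //.
- by apply/measurable_EFinP; exact: measurable_normal_pdf.
- by move=> t _; rewrite lee_fin normal_pdf_ge0.
Qed.

(** A normal distribution function with [2 * s ^+ 2 = (2 * c)^-1], divided by the peak of its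
    density: its increments are at most the total mass, the inverse peak. *)
Lemma gauss_antiderivative (c m : R) : 0 < c -> exists Phi : R -> R,
  (forall x, is_derive x 1 Phi (expR (- (2 * c * (x - m) ^+ 2)))) /\
  forall x y, Phi y - Phi x <= Num.sqrt (2 * pi) / (2 * Num.sqrt c).
Proof.
move=> c0; pose s : R := (2 * Num.sqrt c)^-1.
have sc0 : 0 < Num.sqrt c by rewrite sqrtr_gt0.
have s0 : 0 < s by rewrite invr_gt0 mulr_gt0.
have pk0 : 0 < normal_peak s by rewrite normal_peak_gt0// gt_eqF.
have pkE : (normal_peak s)^-1 = Num.sqrt (2 * pi) / (2 * Num.sqrt c).
  rewrite /normal_peak invrK -mulrnAr mulrC sqrtrM; last by rewrite mulrn_wge0// pi_ge0.
  by rewrite sqrtr_sqr gtr0_norm// mulr_natl.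
pose Phi (x : R) : R := (normal_peak s)^-1 * cdf m s x.
exists Phi; rewrite {}/Phi; split.
  move=> x; have h := is_derive_cdf m x (lt0r_neq0 s0).
  apply: is_derive_eq.
  rewrite normal_pdfE ?gt_eqF// /GRing.scale/= mulrA mulVf ?gt_eqF// mul1r.
  rewrite /normal_fun; congr expR.
  have -> : s ^+ 2 *+ 2 = (2 * c)^-1.
    rewrite /s exprVn exprMn sqr_sqrtr ?ltW//; field; by rewrite gt_eqF.
  by rewrite invrK; ring.
move=> x y; rewrite -mulrBr -pkE ler_piMr ?invr_ge0 ?(ltW pk0)//.
have := cdf_ge0 m s x; have := cdf_le1 m s y; lra.
Qed.

Variables (a b l : R).
Hypotheses (a0 : 0 < a) (b0 : 0 < b) (l0 : 0 < l).

Let phi (x : R) : R := expR (- (2 * b * (l - x) ^+ 2)).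
Let T : R := a * b / (a + b).

Let is_derive_phi (x : R) : is_derive x 1 phi (4 * b * (l - x) * phi x).
Proof.
have h : is_derive x 1 (fun x : R => - (2 * b * (l - x) ^+ 2)) (4 * b * (l - x)).
  by apply: is_derive_eq; rewrite /GRing.scale/=; ring.
apply: (@is_derive_eq _ _ _ _ _ _ _ _
  (@is_derive1_comp _ expR _ x _ _ (is_derive_expR _) h)).
by rewrite mulrC.
Qed.

Let exponentE (x : R) : 2 * b * (l - x) ^+ 2 + 2 * a * x ^+ 2 =
  2 * T * l ^+ 2 + 2 * (a + b) * (x - b * l / (a + b)) ^+ 2.
Proof. by rewrite /T; field; rewrite gt_eqF// addr_gt0. Qed.

(* [H] is an antiderivative of [phi' * expR (- 2 a x^2)]: completing the square
   splits it into an exact derivative and a Gaussian. *)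
Let primitive : exists H : R -> R,
  (forall x : R, is_derive x 1 H (4 * b * (l - x) * phi x * expR (- (2 * a * x ^+ 2)))) /\
  phi 0 + (H l - H 0) <=
  (1 + Num.sqrt (2 * pi) * (2 * T * l) / Num.sqrt (a + b)) * expR (- (2 * T * l ^+ 2)).
Proof.
have ab0 : 0 < a + b by exact: addr_gt0.
have [Phi [dPhi Phile]] := gauss_antiderivative (b * l / (a + b)) ab0.
pose psi (x : R) : R := expR (- (2 * b * (l - x) ^+ 2 + 2 * a * x ^+ 2)).
have dpsi (x : R) : is_derive x 1 psi ((4 * b * (l - x) - 4 * a * x) * psi x).
  have h : is_derive x 1 (fun x : R => - (2 * b * (l - x) ^+ 2 + 2 * a * x ^+ 2))
      (4 * b * (l - x) - 4 * a * x).
    by apply: is_derive_eq; rewrite /GRing.scale/=; ring.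
  apply: (@is_derive_eq _ _ _ _ _ _ _ _
    (@is_derive1_comp _ expR _ x _ _ (is_derive_expR _) h)).
  by rewrite mulrC.
pose K : R := 4 * T * l * expR (- (2 * T * l ^+ 2)).
exists (fun x => b / (a + b) * psi x + K * Phi x); split.
  move=> x; have h1 := dpsi x; have h2 := dPhi x.
  apply: is_derive_eq; rewrite /GRing.scale/=.
  rewrite -[_ * phi x * _]mulrA.
  have -> : phi x * expR (- (2 * a * x ^+ 2)) = psi x by rewrite -expRD -opprD.
  rewrite /K -[4 * T * l * _ * _]mulrA.
  have -> : expR (- (2 * T * l ^+ 2)) * expR (- (2 * (a + b) * (x - b * l / (a + b)) ^+ 2)) = psi x.
    by rewrite -expRD -opprD -exponentE.
  by rewrite /T; field; rewrite gt_eqF.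
(* [T] is at most both [a] and [b], so the two boundary terms, with weights [a / (a + b)] and
   [b / (a + b)], are together at most [X]. *)
have T_le (z y : R) : 0 < z -> 0 < y ->
    expR (- (2 * z * l ^+ 2)) <= expR (- (2 * (z * y / (z + y)) * l ^+ 2)).
  move=> z0 y0; rewrite ler_expR lerN2 ler_wpM2r ?sqr_ge0// ler_wpM2l//.
  by rewrite ler_pdivrMr ?addr_gt0// ler_wpM2l ?(ltW z0)// lerDr ltW.
set X := expR (- (2 * T * l ^+ 2)).
have aX : expR (- (2 * a * l ^+ 2)) <= X by exact: T_le.
have bX : expR (- (2 * b * l ^+ 2)) <= X.
  by apply: le_trans (T_le _ _ b0 a0) _; rewrite /X /T [b * a]mulrC [b + a]addrC.
have -> : phi 0 = expR (- (2 * b * l ^+ 2)) by rewrite /phi subr0.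
have -> : psi l = expR (- (2 * a * l ^+ 2)) by rewrite /psi subrr expr0n/= mulr0 add0r.
have -> : psi 0 = expR (- (2 * b * l ^+ 2)) by rewrite /psi subr0 expr0n/= mulr0 addr0.
move: aX bX; set A := expR _; set B := expR _ => aX bX.
have X0 : 0 < X by exact: expR_gt0.
have T0 : 0 < T by rewrite divr_gt0 ?mulr_gt0.
have K0 : 0 <= K by rewrite ltW// (mulr_gt0 _ X0)// (mulr_gt0 _ l0)// (mulr_gt0 _ T0).
have KP := ler_wpM2l K0 (Phile 0 l).
have sab0 : 0 < Num.sqrt (a + b) by rewrite sqrtr_gt0.
have -> : (1 + Num.sqrt (2 * pi) * (2 * T * l) / Num.sqrt (a + b)) * X =
    X + K * (Num.sqrt (2 * pi) / (2 * Num.sqrt (a + b))).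
  by rewrite /K -/X; field; rewrite gt_eqF.
have -> : B + (b / (a + b) * A + K * Phi l - (b / (a + b) * B + K * Phi 0)) =
    (a / (a + b) * B + b / (a + b) * A) + K * (Phi l - Phi 0).
  by field; rewrite gt_eqF.
apply: lerD => //.
have -> : X = a / (a + b) * X + b / (a + b) * X by field; rewrite gt_eqF.
by apply: lerD; rewrite ler_wpM2l// divr_ge0// ltW.
Qed.

(** A left-endpoint Stieltjes sum of [expR (- (2 * a * x ^+ 2))] against [phi]. With right endpoints
    it lies below the integral given by [primitive]; moving from left to right endpoints costs the
    last factor, which tends to 1 with [M]. *)
Lemma gaussian_convolution_sum (M : nat) : (0 < M)%N ->
  phi 0 + \sum_(k < M) (phi (k.+1%:R * l / M%:R) - phi (k%:R * l / M%:R)) *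
      expR (- (2 * a * (k%:R * l / M%:R) ^+ 2))
  <= (1 + Num.sqrt (2 * pi) * (2 * (a * b / (a + b)) * l) / Num.sqrt (a + b)) *
     expR (- (2 * (a * b / (a + b)) * l ^+ 2)) * expR (4 * a * l ^+ 2 / M%:R).
Proof.
move=> M0; have M0' : 0 < M%:R :> R by rewrite ltr0n.
pose x (k : nat) : R := k%:R * l / M%:R.
have x_ge0 k : 0 <= x k by rewrite divr_ge0 ?mulr_ge0// ltW.
have x_le k k' : (k <= k')%N -> x k <= x k'.
  by move=> kk'; rewrite ler_pM2r ?invr_gt0// ler_pM2r// ler_nat.
have xM : x M = l by rewrite /x mulrAC divff ?mul1r// gt_eqF.
have [H [dH Hle]] := primitive.
set C := expR (4 * a * l ^+ 2 / M%:R).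
have C1 : 1 <= C by rewrite -[leLHS]expR0 ler_expR divr_ge0 ?mulr_ge0 ?sqr_ge0// ltW.
have phi_le y z : y <= z <= l -> phi y <= phi z.
  move=> /andP[yz zl]; rewrite ler_expR lerN2 ler_wpM2l ?mulr_ge0 ?(ltW b0)//.
  by rewrite ler_pXn2r ?nnegrE ?subr_ge0// ?lerB// (le_trans yz).
have step (k : 'I_M) : (phi (x k.+1) - phi (x k)) * expR (- (2 * a * x k ^+ 2)) <=
    C * (H (x k.+1) - H (x k)).
  have kM : x k.+1 <= l by rewrite -xM x_le.
  have kk1 : x k <= x k.+1 by exact: x_le.
  pose D := expR (- (2 * a * x k.+1 ^+ 2)).
  have HD : (phi (x k.+1) - phi (x k)) * D <= H (x k.+1) - H (x k).
    pose F (z : R) : R := H z - D * phi z.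
    have dF (z : R) : is_derive z 1 F (4 * b * (l - z) * phi z * (expR (- (2 * a * z ^+ 2)) - D)).
      have h1 := dH z; have h2 := is_derive_phi z.
      by apply: is_derive_eq; rewrite /GRing.scale/=; ring.
    have : F (x k) <= F (x k.+1).
      apply: (is_derive_ge0_le kk1 (fun z _ => dF z)) => z /andP[kz zk].
      rewrite !mulr_ge0 ?subr_ge0 ?expR_ge0 ?(ltW b0)//.
        by rewrite (le_trans (ltW zk)).
      rewrite ler_expR lerN2 ler_wpM2l ?mulr_ge0 ?(ltW a0)//.
      by rewrite ler_pXn2r ?nnegrE ?(ltW zk)// (le_trans (x_ge0 k))// ltW.
    by rewrite /F; lra.
  have CD : expR (- (2 * a * x k ^+ 2)) <= D * C.
    rewrite -expRD ler_expR.
    have : x k.+1 ^+ 2 - x k ^+ 2 <= 2 * l ^+ 2 / M%:R.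
      rewrite subr_sqr.
      have -> : x k.+1 - x k = l / M%:R by rewrite /x -natr1; field; rewrite gt_eqF.
      have -> : 2 * l ^+ 2 / M%:R = l / M%:R * (2 * l) by field; rewrite gt_eqF.
      rewrite ler_wpM2l ?divr_ge0 ?(ltW l0)//; lra.
    have -> : 4 * a * l ^+ 2 / M%:R = 2 * a * (2 * l ^+ 2 / M%:R) by field; rewrite gt_eqF.
    move=> h; have := ler_wpM2l (mulr_ge0 (ler0n R 2) (ltW a0)) h; lra.
  have d0 : 0 <= phi (x k.+1) - phi (x k) by rewrite subr_ge0 phi_le// kk1.
  apply: le_trans (ler_wpM2l d0 CD) _; rewrite mulrA [leRHS]mulrC.
  by rewrite ler_wpM2r ?(le_trans ler01 C1).
apply: (@le_trans _ _ (C * (phi 0 + (H l - H 0)))); last first.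
  by rewrite mulrC ler_wpM2r// (le_trans ler01 C1).
rewrite mulrDr; apply: lerD; first by rewrite ler_peMl ?expR_ge0.
apply: le_trans (ler_sum _ (fun k _ => step k)) _.
rewrite -mulr_sumr -(big_mkord xpredT (fun k => H (x k.+1) - H (x k))) telescope_sumr//.
by rewrite xM /x !mul0r.
Qed.

End gaussian_convolution.

(** * The two-sample inequality on a grid *)

(* [rho i j] says that calibration point [i] is at least as extreme as test
   point [j]; then [1 + #|[set i | rho i j]|] over [n + 1] is the conformal p-value. *)
Definition ecdf_exceeds (R : realType) (I J : finType) (l : R) (rho : I -> J -> bool) : bool :=
  [exists k : 'I_#|I|.+1, #|J|%:R * (k%:R / #|I|.+1%:R + l) <
     (#|[set j : J | (#|[set i : I | rho i j]%SET| < k)%N]%SET|)%:R].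

(** The convolution bound for rates [n] and [r]. Equating it to [delta] and solving for the [l] of
    the exponent gives the fixed-point equation iterated by [Psi]. *)
Definition dkw_bound (R : realType) (n r : nat) (l : R) : R :=
  (1 + Num.sqrt (2 * pi) * (2 * tau n r * l) / Num.sqrt (n + r)%:R) *
  expR (- (2 * tau n r * l ^+ 2)).

Section grid_two_sample.
Variables (R : realType) (I J : finType) (G : nat) (l : R).
Hypotheses (I0 : (0 < #|I|)%N) (J0 : (0 < #|J|)%N) (l0 : 0 < l).

Let n := #|I|.
Let r := #|J|.
Let phi (x : R) : R := expR (- (2 * r%:R * (l - x) ^+ 2)).
(** [grid_DKW] controls excesses only. A deficit of calibration points at low positions is an excess
    for the reversed positions, whence [rev_ord]. *)
Let U_exceeds (U : {ffun I -> 'I_G}) (x : R) : bool :=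
  [exists a : 'I_G.+1, n%:R * (a%:R / G%:R + x) < (#|[set i | (rev_ord (U i) < a)%N]%SET|)%:R].
Let bad (U : {ffun I -> 'I_G}) (W : {ffun J -> 'I_G}) :=
  ecdf_exceeds l (fun i j => (U i <= W j)%N).

Let card_U_exceeds x : 0 <= x ->
  (#|[set U | U_exceeds U x]%SET|)%:R <= G%:R ^+ n * expR (- (2 * n%:R * x ^+ 2)) :> R.
Proof.
move=> x0; apply: le_trans (grid_DKW I G x0); rewrite ler_nat.
pose f (U : {ffun I -> 'I_G}) := [ffun i => rev_ord (U i)].
have fK : involutive f by move=> U; apply/ffunP => i; rewrite !ffunE rev_ordK.
rewrite -(card_imset _ (inv_inj fK)); apply: subset_leq_card. apply/fintype.subsetP => V.
move=> /imsetP[U]; rewrite inE => /existsP[a Ua] ->; rewrite inE; apply/existsP; exists a.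
apply: lt_le_trans Ua _; rewrite ler_nat; apply: subset_leq_card.
by apply/fintype.subsetP => i; rewrite !inE ffunE.
Qed.

(** Triangle inequality: if the calibration sample deviates from the grid by at most [x], the test
    sample must deviate from it by more than [l - x]. *)
Let card_bad U x : 0 <= x <= l -> ~~ U_exceeds U x ->
  (#|[set W | bad U W]%SET|)%:R <= G%:R ^+ r * phi x.
Proof.
move=> /andP[x0 xl] Ux; have lx : 0 <= l - x by rewrite subr_ge0.
apply: le_trans (grid_DKW J G lx); rewrite ler_nat; apply: subset_leq_card.
apply/fintype.subsetP => W; rewrite !inE => /existsP[k]; rewrite -/n -/r => hk.
have [j0 j0k] : exists j0, j0 \in [set j | (#|[set i | (U i <= W j)%N]%SET| < k)%N]%SET.
  apply/finset.set0Pn; apply/eqP => k0; move: hk; rewrite k0 cards0 ltNge.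
  by rewrite mulr_ge0// addr_ge0 ?divr_ge0// ltW.
(* The grid level to test is just above the largest counted test point: all counted points lie below
   it, and fewer than [k] calibration points do. *)
case: (@arg_maxnP _ j0 (mem [set j | (#|[set i | (U i <= W j)%N]%SET| < k)%N]%SET)
  (fun j => W j) j0k) => j jk jmax.
have aG : ((W j).+1 < G.+1)%N by rewrite ltnS.
apply/existsP; exists (Ordinal aG) => /=.
apply: (@lt_le_trans _ _ (#|[set j | (#|[set i | (U i <= W j)%N]%SET| < k)%N]%SET|)%:R); last first.
  rewrite ler_nat; apply: subset_leq_card; apply/fintype.subsetP => j' j'k.
  by rewrite inE ltnS; exact: jmax.
apply: le_lt_trans hk; rewrite ler_wpM2l//.
have G0 : (0 < G)%N by exact: leq_ltn_trans (ltn_ord (W j)).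
have GR : 0 < G%:R :> R by rewrite ltr0n.
have nR : 0 < n%:R :> R by rewrite ltr0n.
have Ga : (G - (W j).+1 < G.+1)%N by rewrite ltnS leq_subr.
move: Ux => /existsPn/(_ (Ordinal Ga)); rewrite -leNgt/=.
have cE : #|[set i | (rev_ord (U i) < G - (W j).+1)%N]%SET| =
    (n - #|[set i | (U i <= W j)%N]%SET|)%N.
  rewrite /n -(cardsC [set i | (U i <= W j)%N]%SET) addKn; apply: eq_card => i.
  by rewrite !inE /=; have := ltn_ord (U i); have := ltn_ord (W j); lia.
move: jk; rewrite !inE cE.
set c := #|[set i | _]%SET| => ck.
have cn : (c <= n)%N by exact: max_card.
have kn : (k <= n)%N by rewrite -ltnS.
rewrite !natrB// => hU.
have ck1 : c%:R + 1 <= k%:R :> R by rewrite natr1 ler_nat.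
have kn' : k%:R <= n%:R :> R by rewrite ler_nat.
have hw : (W j).+1%:R / G%:R <= x + (k%:R - 1) / n%:R :> R.
  rewrite -subr_ge0 -(pmulr_rge0 _ nR).
  have -> : n%:R * (x + (k%:R - 1) / n%:R - (W j).+1%:R / G%:R) =
      n%:R * ((G%:R - (W j).+1%:R) / G%:R + x) - (n%:R - c%:R) + (k%:R - (c%:R + 1)) :> R.
    by field; rewrite !gt_eqF.
  by rewrite addr_ge0// subr_ge0.
(* Fewer than [k] means at most [k - 1]; this unit pays for the passage from denominator [n] to
   [n + 1], as [k <= n + 1]. *)
have hk1 : (k%:R - 1) / n%:R <= k%:R / n.+1%:R :> R.
  rewrite ler_pdivrMr// mulrAC ler_pdivlMr ?ltr0n// -natr1; nra.
by move: hw hk1; move: (_ / G%:R) (_ / n%:R) (_ / n.+1%:R) => u v z; lra.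
Qed.

(** [card_bad] is applied at the first layer that [U] does not exceed; [phi] there telescopes over
    the layers before it, all exceeded, and later terms are nonnegative. *)
Let bad_layers U (M : nat) : (0 < M)%N ->
  (#|[set W | bad U W]%SET|)%:R <= G%:R ^+ r * (phi 0 +
    \sum_(k < M) (phi (k.+1%:R * l / M%:R) - phi (k%:R * l / M%:R)) *
      (U_exceeds U (k%:R * l / M%:R))%:R).
Proof.
move=> M0; have M0' : 0 < M%:R :> R by rewrite ltr0n.
pose x (k : nat) : R := k%:R * l / M%:R.
have x_ge0 k : 0 <= x k by rewrite divr_ge0 ?mulr_ge0// ltW.
have x_le k k' : (k <= k')%N -> x k <= x k'.
  by move=> kk'; rewrite ler_pM2r ?invr_gt0// ler_pM2r// ler_nat.
have xM : x M = l by rewrite /x mulrAC divff ?mul1r// gt_eqF.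
have phi_le y z : y <= z <= l -> phi y <= phi z.
  move=> /andP[yz zl]; rewrite ler_expR lerN2 ler_wpM2l ?mulr_ge0//.
  by rewrite ler_pXn2r ?nnegrE ?subr_ge0// ?lerB// (le_trans yz).
have dphi (k : nat) : (k < M)%N -> 0 <= phi (x k.+1) - phi (x k).
  by move=> kM; rewrite subr_ge0 phi_le// x_le// -xM x_le.
pose first_ok k := (k == M) || ~~ U_exceeds U (x k).
have ex_ok : exists k, first_ok k by exists M; rewrite /first_ok eqxx.
case: (ex_minnP ex_ok) => K okK minK.
have KM : (K <= M)%N by apply: minK; rewrite /first_ok eqxx.
have sumK : phi (x K) <= phi 0 + \sum_(k < M) (phi (x k.+1) - phi (x k)) * (U_exceeds U (x k))%:R.
  rewrite -(big_mkord xpredT (fun k => (phi (x k.+1) - phi (x k)) * (U_exceeds U (x k))%:R)).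
  rewrite (@big_cat_nat _ _ _ K)//= addrA.
  have -> : \sum_(0 <= k < K) (phi (x k.+1) - phi (x k)) * (U_exceeds U (x k))%:R =
      phi (x K) - phi 0.
    rewrite (eq_big_nat _ _ (F2 := fun k => phi (x k.+1) - phi (x k))).
      by rewrite telescope_sumr// /x !mul0r.
    move=> k /andP[_ kK]; have -> : U_exceeds U (x k); last by rewrite mulr1.
    apply: contraLR kK => Uk; rewrite -leqNgt; apply: minK; rewrite /first_ok Uk orbT//.
  rewrite [phi 0 + _]addrC subrK lerDl big_seq_cond sumr_ge0// => k.
  by rewrite mem_index_iota andbT => /andP[_ kM]; rewrite mulr_ge0// dphi.
have G0 : 0 <= G%:R ^+ r :> R by rewrite exprn_ge0.
apply: le_trans (ler_wpM2l G0 sumK).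
(* If all layers are exceeded, [phi l = 1] and the bound is the number of all [W]. *)
case/orP: okK => [/eqP->|UK]; last first.
  by apply: card_bad => //; rewrite x_ge0 -xM x_le.
rewrite xM /phi subrr expr0n/= mulr0 oppr0 expR0 mulr1 -natrX ler_nat.
by rewrite (leq_trans (max_card _))// card_ffun card_ord.
Qed.

Lemma grid_two_sample (M : nat) : (0 < M)%N ->
  (#|[set UW : {ffun I -> 'I_G} * {ffun J -> 'I_G} |
      ecdf_exceeds l (fun i j => (UW.1 i <= UW.2 j)%N)]%SET|)%:R <=
  G%:R ^+ (#|I| + #|J|) * (dkw_bound #|I| #|J| l * expR (4 * #|I|%:R * l ^+ 2 / M%:R)).
Proof.
move=> M0.
have nR : 0 < n%:R :> R by rewrite ltr0n.
have rR : 0 < r%:R :> R by rewrite ltr0n.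
have -> : dkw_bound #|I| #|J| l =
    (1 + Num.sqrt (2 * pi) * (2 * (n%:R * r%:R / (n%:R + r%:R)) * l) / Num.sqrt (n%:R + r%:R)) *
     expR (- (2 * (n%:R * r%:R / (n%:R + r%:R)) * l ^+ 2)).
  by rewrite /dkw_bound /tau -/n -/r natrM natrD.
apply: (@le_trans _ _ (G%:R ^+ (n + r) * _)); last first.
  by apply: ler_wpM2l; [rewrite exprn_ge0|exact: (gaussian_convolution_sum nR rR l0 M0)].
rewrite -sum1_card natr_sum.
rewrite (eq_bigl (fun UW => bad UW.1 UW.2)); last by move=> UW; rewrite inE.
rewrite -(pair_big_dep xpredT (fun U W => bad U W) (fun U W => 1))/=.
have inner U : \sum_(W | bad U W) (1 : R) = (#|[set W | bad U W]%SET|)%:R.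
  by rewrite -sum1_card natr_sum; apply: eq_bigl => W; rewrite inE.
under eq_bigr do rewrite inner.
apply: le_trans (ler_sum _ (fun U _ => bad_layers U M0)) _.
rewrite -mulr_sumr exprD [G%:R ^+ n * _]mulrC -[leRHS]mulrA ler_wpM2l ?exprn_ge0//.
rewrite big_split/= mulrDr; apply: lerD.
  rewrite sumr_const card_ffun card_ord -[_ *+ _]mulr_natl natrX.
  by rewrite /phi.
rewrite exchange_big/= mulr_sumr; apply: ler_sum => k _.
rewrite -mulr_sumr mulrCA.
have kM : (k%:R * l / M%:R : R) <= k.+1%:R * l / M%:R <= l.
  rewrite ler_pM2r ?invr_gt0 ?ltr0n// ler_pM2r// ler_nat leqnSn/=.
  by rewrite ler_pdivrMr ?ltr0n// mulrC ler_pM2l// ler_nat.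
have dphi : 0 <= phi (k.+1%:R * l / M%:R) - phi (k%:R * l / M%:R).
  case/andP: kM => kk kl; rewrite subr_ge0 ler_expR lerN2 ler_wpM2l ?mulr_ge0//.
  by rewrite ler_pXn2r ?nnegrE ?subr_ge0// ?lerB// (le_trans kk).
apply: ler_wpM2l => //.
have x0 : 0 <= k%:R * l / M%:R by rewrite divr_ge0 ?mulr_ge0// ltW.
apply: le_trans (card_U_exceeds x0).
rewrite -sum1_card natr_sum [leRHS]big_mkcond; apply: ler_sum => U _.
by rewrite inE; case: ifP.
Qed.

End grid_two_sample.

(** * Random permutations *)

(** Each injective function identifies [X] with its ranks; [sg] follows one identification and the
    inverse of the other. *)
Lemma order_matching_perm (R : realDomainType) (X : finType) (s f : X -> R) :
  injective s -> injective f ->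
  exists sg : {perm X}, forall x y, (s (sg x) <= s (sg y)) = (f x <= f y).
Proof.
pose rk (h : X -> R) x := #|[set y | h y < h x]%SET|.
have rk_lt h x : (rk h x < #|X|)%N.
  rewrite -cardsT; apply: proper_card; rewrite properE finset.subsetT /=.
  by apply/fintype.subsetPn; exists x; rewrite !inE ?ltxx.
have rk_mono h x y : (rk h x < rk h y)%N = (h x < h y).
  have rk_le x' y' : h x' <= h y' -> (rk h x' <= rk h y')%N.
    move=> xy; apply: subset_leq_card; apply/fintype.subsetP => z; rewrite !inE => zx.
    exact: lt_le_trans xy.
  have [yx|xy] := leP (h y) (h x); first by rewrite ltnNge rk_le.
  apply: proper_card; apply/properP; split.
    by apply/fintype.subsetP => z; rewrite !inE => /lt_trans; apply.
  by exists x; rewrite !inE ?ltxx.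
pose m (h : X -> R) x : X := enum_val (Ordinal (rk_lt h x)).
have m_inj h : injective h -> injective (m h).
  move=> hi x y /enum_val_inj[] rxy; apply: hi; apply/eqP; rewrite eq_le.
  by rewrite !leNgt -!rk_mono rxy ltnn.
move=> si fi; pose sg : {perm X} := (perm (m_inj _ fi) * (perm (m_inj _ si))^-1)%g.
exists sg => x y.
have rkE z : rk s (sg z) = rk f z.
  have : m s (sg z) = m f z.
    by rewrite -[m s _](permE (m_inj _ si)) permM permKV permE.
  by move=> /enum_val_inj[].
by rewrite !leNgt -!rk_mono !rkE.
Qed.

Lemma card_ffun_sum_le (I J : finType) (G : nat)
    (P : (I -> nat) -> (J -> nat) -> bool) :
  (#|[set f : {ffun I + J -> 'I_G} | P (fun i => f (inl i)) (fun j => f (inr j))]%SET| <=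
   #|[set UW : {ffun I -> 'I_G} * {ffun J -> 'I_G} |
       P (fun i => UW.1 i) (fun j => UW.2 j)]%SET|)%N.
Proof.
pose h (f : {ffun I + J -> 'I_G}) : {ffun I -> 'I_G} * {ffun J -> 'I_G} :=
  ([ffun i => f (inl i)], [ffun j => f (inr j)]).
have h_inj : injective h.
  move=> f g [] /ffunP fgl /ffunP fgr; apply/ffunP => -[i|j].
    by have := fgl i; rewrite !ffunE.
  by have := fgr j; rewrite !ffunE.
rewrite -(card_imset _ h_inj); apply: subset_leq_card; apply/fintype.subsetP => V.
move=> /imsetP[f]; rewrite !inE => Pf -> /=; move: Pf; congr (is_true (P _ _)).
  by apply/funext => i; rewrite ffunE.
by apply/funext => i; rewrite ffunE.
Qed.

(** Injective maps make up a share of at least [1 - N ^ 2 / G] of all maps, so ties on the grid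
    disappear as [G] grows. *)
Lemma ffact_ge (N G : nat) (R : realType) : (0 < G)%N ->
  G%:R ^+ N * (1 - (N ^ 2)%:R / G%:R) <= (G ^_ N)%:R :> R.
Proof.
move=> G0; have GR : 0 < G%:R :> R by rewrite ltr0n.
elim: N => [|N IH]; first by rewrite expr0 ffactn0 mul1r mul0r subr0.
rewrite ffactnSr exprSr natrM.
have [NG|GN] := leqP N G; last first.
  rewrite ffact_small// mul0r -mulrA mulr_ge0_le0 ?exprn_ge0//.
  rewrite pmulr_rle0// subr_le0 ler_pdivlMr// mul1r ler_nat; nia.
rewrite natrB//.
have [s0|s0] := leP 0 (1 - (N ^ 2)%:R / G%:R : R); last first.
  apply: (@le_trans _ _ 0); last by rewrite mulr_ge0// subr_ge0 ler_nat.
  rewrite -mulrA mulr_ge0_le0 ?exprn_ge0// pmulr_rle0//.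
  apply: le_trans (ltW s0); rewrite lerB// ler_pM2r ?invr_gt0// ler_nat; nia.
apply: le_trans (ler_wpM2r _ IH); last by rewrite subr_ge0 ler_nat.
rewrite -!mulrA ler_wpM2l ?exprn_ge0//.
have -> : (N.+1 ^ 2)%:R = (N ^ 2)%:R + 2 * N%:R + 1 :> R.
  by rewrite !natrX -natr1; ring.
have : 0 <= N%:R * (N ^ 2)%:R / G%:R :> R by rewrite divr_ge0// mulr_ge0.
have -> : G%:R * (1 - ((N ^ 2)%:R + 2 * N%:R + 1) / G%:R) =
   G%:R - (N ^ 2)%:R - 2 * N%:R - 1 :> R by field; rewrite gt_eqF.
have -> : (1 - (N ^ 2)%:R / G%:R) * (G%:R - N%:R) =
   G%:R - (N ^ 2)%:R - N%:R + N%:R * (N ^ 2)%:R / G%:R :> R by field; rewrite gt_eqF.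
have : 0 <= N%:R :> R by []; lra.
Qed.

Section permuted_scores.
Variables (R : realType) (I J : finType) (l : R) (s : (I + J)%type -> R).
Hypotheses (I0 : (0 < #|I|)%N) (J0 : (0 < #|J|)%N) (l0 : 0 < l).
Hypothesis s_inj : injective s.

Let X := (I + J)%type.
Let N := #|{: X}|.
Let badp (t : X -> R) := ecdf_exceeds l (fun i j => t (inr j) <= t (inl i)).
Let badf G (f : {ffun X -> 'I_G}) :=
  ecdf_exceeds l (fun i j => (f (inl i) <= f (inr j))%N).
Let c := #|[set p : {perm X} | badp (fun x => s (p x))]%SET|.

Let eq_bad (rho rho' : I -> J -> bool) : (forall i j, rho i j = rho' i j) ->
  ecdf_exceeds l rho = ecdf_exceeds l rho'.
Proof. by move=> e; congr ecdf_exceeds; apply/funext => i; apply/funext => j. Qed.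

(** Matching the order of the scores with that of [- f] is a right translation of the permutation
    group, so the count is the same for all injective [f]. The sign appears because extreme means a
    large score but a small grid position. *)
Let perm_count G (f : {ffun X -> 'I_G}) : injective f ->
  #|[set p : {perm X} | badf [ffun x => f (p x)]]%SET| = c.
Proof.
move=> f_inj.
have nf_inj : injective (fun x => - (f x : nat)%:R : R).
  move=> x y /oppr_inj /eqP; rewrite eqr_nat => /eqP/val_inj; exact: f_inj.
have [sg sgE] := order_matching_perm s_inj nf_inj.
rewrite /c -(card_imset _ (@mulIg _ sg)); apply: eq_card => p; rewrite !inE.
apply/imsetP/idP => [[p'] |bp].
  rewrite inE => bp' ->; move: bp'; rewrite /badf /badp; congr is_true; apply: eq_bad => i j.
  by rewrite !ffunE !permM sgE lerN2 ler_nat.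
exists (p * sg^-1)%g; last by rewrite mulgVK.
rewrite inE; move: bp; rewrite /badf /badp; congr is_true; apply: eq_bad => i j.
by rewrite !ffunE -[p in LHS](mulgVK sg) !permM sgE lerN2 ler_nat.
Qed.

(** Count the pairs of an injective [f] and a permutation [p] with [f] after [p] bad: each [f] gives
    [c], and for each [p] composition with [p] is a bijection of the maps. *)
Let double_count G : (G ^_ N * c <= N`! * #|[set f : {ffun X -> 'I_G} | badf f]%SET|)%N.
Proof.
have -> : (G ^_ N * c = \sum_(f : {ffun X -> 'I_G} | injectiveb f)
    \sum_(p : {perm X}) badf [ffun x => f (p x)])%N.
  rewrite (eq_bigr (fun=> c)); last first.
    move=> f /injectiveP f_inj; rewrite -(perm_count f_inj) -sum1_card [in RHS]big_mkcond.
    by apply: eq_bigr => p _; rewrite inE.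
  rewrite sum_nat_const; congr muln.
  rewrite -[G in LHS]card_ord -card_inj_ffuns; apply: eq_card => f; by rewrite !inE.
rewrite exchange_big/=.
have -> : N`! = #|{: {perm X}}|.
  rewrite /N -cardsT -card_perm; apply: eq_card => p; rewrite !inE.
  by apply/fintype.subsetP => x _; rewrite inE.
rewrite -sum_nat_const; apply: leq_sum => p _.
pose h (q : {perm X}) (f : {ffun X -> 'I_G}) := [ffun x => f (q x)].
have hK : cancel (h p^-1%g) (h p) by move=> f; apply/ffunP => x; rewrite !ffunE permK.
have hK' : cancel (h p) (h p^-1%g) by move=> f; apply/ffunP => x; rewrite !ffunE permKV.
rewrite (reindex (h p^-1%g))/=; last by exists (h p) => f _; [exact: hK|exact: hK'].
rewrite -sum1_card [leqRHS]big_mkcond [leqLHS]big_mkcond/=; apply: leq_sum => f _.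
by rewrite -/(h p _) hK inE; case: ifP.
Qed.

Lemma card_perm_ecdf_exceeds :
  (#|[set p : {perm X} | ecdf_exceeds l (fun i j => s (p (inr j)) <= s (p (inl i)))]%SET|)%:R
  <= (#|{: X}|)`!%:R * dkw_bound #|I| #|J| l.
Proof.
rewrite -/N; set D := dkw_bound _ _ _; rewrite -[leLHS]/(c%:R).
pose K : R := 4 * #|I|%:R * l ^+ 2.
(* The grid size and the number of layers are both [g.+1], and tend to infinity together. *)
have NE : N = (#|I| + #|J|)%N by rewrite /N card_sum.
have main g : c%:R * (1 - (N ^ 2)%:R * g.+1%:R^-1) <= N`!%:R * (D * expR (K * g.+1%:R^-1)) :> R.
  have GN : 0 < g.+1%:R ^+ N :> R by rewrite exprn_gt0.
  rewrite -(ler_pM2l GN) mulrCA.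
  apply: (@le_trans _ _ (c%:R * (g.+1 ^_ N)%:R)).
    by rewrite ler_wpM2l// ffact_ge.
  rewrite -natrM mulnC.
  have := double_count g.+1; rewrite -(ler_nat R) => /le_trans; apply.
  rewrite natrM [leRHS]mulrCA ler_wpM2l// NE.
  have := @grid_two_sample R I J g.+1 l I0 J0 l0 g.+1 isT; apply: le_trans.
  rewrite ler_nat.
  exact: (@card_ffun_sum_le I J g.+1 (fun U W => ecdf_exceeds l (fun i j => (U i <= W j)%N))).
have lhs : (c%:R * (1 - (N ^ 2)%:R * g.+1%:R^-1)) @[g --> \oo] --> (c%:R : R).
  have : (c%:R * (1 - (N ^ 2)%:R * g.+1%:R^-1)) @[g --> \oo] --> (c%:R * (1 - (N ^ 2)%:R * 0) : R).
    apply: cvgMr; apply: cvgB; first exact: cvg_cst.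
    by apply: cvgMr; exact: cvg_harmonic.
  by rewrite mulr0 subr0 mulr1.
have rhs : (N`!%:R * (D * expR (K * g.+1%:R^-1))) @[g --> \oo] --> (N`!%:R * D : R).
  have : (N`!%:R * (D * expR (K * g.+1%:R^-1))) @[g --> \oo] --> (N`!%:R * (D * expR (K * 0)) : R).
    apply: cvgMr; apply: cvgMr; apply: (@cvg_comp _ _ _ (fun g => K * g.+1%:R^-1) expR).
      by apply: cvgMr; exact: cvg_harmonic.
    exact: continuous_expR.
  by rewrite mulr0 expR0 mulr1.
by apply: ler_cvg_to lhs rhs _; apply: nearW.
Qed.

End permuted_scores.

(** * Exchangeability of independent families *)

Section tuple_laws.
Context {d dE : measure_display} {T : measurableType d} {E : measurableType dE} {R : realType}.
Variable P : probability T R.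

Let rectangle M (B : 'I_M -> set E) : set (M.-tuple E) := [set y | forall i, B i (tnth y i)].

(** Rectangles are stable under intersection, so with this generation statement they determine a law
    on tuples. *)
Let tuple_measurableE M :
  (@measurable _ (M.-tuple E)) =
  <<s [set C | exists2 B : 'I_M -> set E, (forall i, measurable (B i)) & C = rectangle B] >>.
Proof.
have rect_meas (B : 'I_M -> set E) : (forall i, measurable (B i)) ->
    measurable (rectangle B).
  move=> mB; have -> : rectangle B = \big[setI/setT]_(i < M) ((@tnth M E ^~ i) @^-1` B i).
    rewrite -bigcap_seq; apply/seteqP; split => y yB /=; first by move=> i _; exact: yB.
    by move=> i; apply: yB; rewrite /= mem_index_enum.
  apply: bigsetI_measurable => i _; rewrite -[X in measurable X]setTI.
  exact: measurable_tnth.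
apply/seteqP; split.
  apply: smallest_sub; first exact: smallest_sigma_algebra.
  rewrite -bigcup_seq => C [i _ [B mB <-]]; rewrite setTI; apply: sub_sigma_algebra.
  exists (fun j => if j == i then B else setT) => [j|]; first by case: ifP.
  apply/seteqP; split => y /=; last by move/(_ i); rewrite eqxx.
  by move=> yB j; case: eqP => [->|].
apply: smallest_sub; first exact: sigma_algebra_measurable.
by move=> C [B mB ->]; exact: rect_meas.
Qed.

Lemma tuple_law_unique M (Y Y' : T -> M.-tuple E) :
  measurable_fun setT Y -> measurable_fun setT Y' ->
  (forall B : 'I_M -> set E, (forall i, measurable (B i)) ->
    P [set w | forall i, B i (tnth (Y w) i)] = P [set w | forall i, B i (tnth (Y' w) i)]) ->
  forall A, measurable A -> P (Y @^-1` A) = P (Y' @^-1` A).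
Proof.
move=> mY mY' YY' A mA.
pose Ym : {mfun T >-> M.-tuple E} := mfun_Sub (mem_set mY).
pose Ym' : {mfun T >-> M.-tuple E} := mfun_Sub (mem_set mY').
apply: (@measure_unique _ R _ _ (fun=> setT) (tuple_measurableE M) _ _ _
  (pushforward P Ym) (pushforward P Ym') _ _ A mA).
- move=> _ _ [B mB ->] [B' mB' ->]; exists (fun i => B i `&` B' i).
    by move=> i; exact: measurableI.
  apply/seteqP; split => y /=; first by move=> [yB yB'] i; split.
  by move=> yB; split => i; case: (yB i).
- by move=> _; exists (fun=> setT) => //; apply/seteqP; split.
- by rewrite bigcup_const.
- by move=> _ [B mB ->]; exact: YY'.
- move=> _; have : (P setT < +oo)%E by rewrite probability_setT ltry.
  exact.
Qed.

Lemma mutual_indep_perm (K : finType) (Z : K -> T -> E) (k : {perm K}) :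
  (forall i, measurable_fun setT (Z i)) -> mutual_indep P Z ->
  (forall i B, measurable B -> P (Z (k i) @^-1` B) = P (Z i @^-1` B)) ->
  forall A : set (#|K|.-tuple E), measurable A ->
    P ((fun w => [tuple Z (k (enum_val i)) w | i < #|K|]) @^-1` A) =
    P ((fun w => [tuple Z (enum_val i) w | i < #|K|]) @^-1` A).
Proof.
move=> mZ indZ lawZ.
have mY (h : K -> K) : measurable_fun setT (fun w => [tuple Z (h (enum_val i)) w | i < #|K|]).
  apply/measurable_fun_tnthP => i; rewrite [X in measurable_fun _ X](_ : _ = Z (h (enum_val i))) //.
  by apply/funext => w /=; rewrite tnth_mktuple.
apply: tuple_law_unique => [||B mB]; [exact: mY|exact: (mY id)|].
pose C (i : K) := B (enum_rank i).
have -> : [set w | forall i, B i (tnth [tuple Z (k (enum_val i)) w | i < #|K|] i)] =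
    [set w | forall i, C (k^-1 i)%g (Z i w)].
  apply/seteqP; split => w /= h i.
    by have := h (enum_rank (k^-1 i)%g); rewrite tnth_mktuple enum_rankK permKV.
  by have := h (k (enum_val i)); rewrite tnth_mktuple permK /C enum_valK.
have -> : [set w | forall i, B i (tnth [tuple Z (enum_val i) w | i < #|K|] i)] =
    [set w | forall i, C i (Z i w)].
  apply/seteqP; split => w /= h i.
    by have := h (enum_rank i); rewrite tnth_mktuple enum_rankK.
  by have := h (enum_val i); rewrite tnth_mktuple /C enum_valK.
rewrite (indZ C); last by move=> i; exact: mB.
rewrite (indZ (fun i => C (k^-1 i)%g)); last by move=> i; exact: mB.
rewrite (reindex_inj (@perm_inj _ k))/=; apply: eq_bigr => i _.
by rewrite permK lawZ//; exact: mB.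
Qed.

(** There are finitely many comparison patterns, so any event read off them is a finite union of
    finite intersections. This covers both ties and empirical excesses. *)
Lemma measurable_order_pattern (L : finType) (s : T -> L -> R)
    (Q : {ffun L * L -> bool} -> bool) :
  (forall x, measurable_fun setT (s ^~ x)) ->
  measurable [set w | Q [ffun c => s w c.1 <= s w c.2]].
Proof.
move=> ms.
have -> : [set w | Q [ffun c => s w c.1 <= s w c.2]] =
    \big[setU/set0]_(c : {ffun L * L -> bool} | Q c)
      \big[setI/setT]_(x : L * L) [set w | (s w x.1 <= s w x.2) = c x].
  rewrite -bigcup_seq_cond; apply/seteqP; split => w /=.
    move=> Qw; exists [ffun c => s w c.1 <= s w c.2]; first by rewrite /= mem_index_enum.
    by rewrite -bigcap_seq => x _ /=; rewrite ffunE.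
  move=> [c /= /andP[_ Qc]]; rewrite -bigcap_seq => h.
  suff -> : [ffun c => s w c.1 <= s w c.2] = c by [].
  by apply/ffunP => x; rewrite ffunE; apply: h; rewrite /= mem_index_enum.
apply: bigsetU_measurable => c _; apply: bigsetI_measurable => x _.
rewrite -[X in measurable X]setTI.
exact: (measurable_fun_ler (ms x.1) (ms x.2) measurableT (Y := [set c x])).
Qed.

(** The sum is the expected number of events that occur; it transfers a count valid at each [w] to
    probabilities. *)
Lemma sum_probability_le (F : finType) (A : F -> set T) (c : R) :
  (forall f, measurable (A f)) ->
  (forall w, (#|[set f | `[< A f w >]]%SET|)%:R <= c) ->
  (\sum_(f : F) P (A f) <= c%:E)%E.
Proof.
move=> mA Ac.
have -> : (\sum_(f : F) P (A f) = \int[P]_w \sum_(f : F) (\1_(A f) w)%:E)%E.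
  rewrite ge0_integral_sum//; last by move=> f; apply/measurable_EFinP; exact: measurable_indic.
  by apply: eq_bigr => f _; rewrite integral_indic// setIT.
have c0 : 0 <= c by have := Ac point; exact: le_trans.
apply: (@le_trans _ _ (\int[P]_w (cst c%:E w))%E); last first.
  by rewrite integral_cst//= probability_setT mule1.
apply: ge0_le_integral => //.
- by move=> w _; apply: sume_ge0 => f _; rewrite lee_fin.
- by apply: emeasurable_sum => f; apply/measurable_EFinP; exact: measurable_indic.
- move=> w _; rewrite sumEFin lee_fin /=; apply: le_trans (Ac w).
  rewrite -sum1_card natr_sum [leRHS]big_mkcond/=; apply: ler_sum => f _.
  by rewrite inE indicE; case: asboolP => h; [rewrite mem_set|rewrite memNset].
Qed.

End tuple_laws.

(** * The iterated radius *)

Section iterated_radius.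
Variable R : realType.
Implicit Types (n r : nat) (delta x y u : R).

Let L delta n r x : R :=
  ln (delta^-1) + ln (1 + Num.sqrt (2 * pi) * (2 * tau n r * x) / Num.sqrt (n + r)%:R).

Let tau_gt0 n r : (0 < n)%N -> (0 < r)%N -> 0 < tau n r :> R.
Proof. by move=> n0 r0; rewrite divr_gt0// ltr0n ?muln_gt0 ?addn_gt0 ?n0. Qed.

Let tau_ge0 n r : 0 <= tau n r :> R.
Proof. by rewrite divr_ge0. Qed.

Let slope_ge0 n r x : 0 <= x ->
  0 <= Num.sqrt (2 * pi) * (2 * tau n r * x) / Num.sqrt (n + r)%:R :> R.
Proof. by move=> x0; rewrite divr_ge0 ?sqrtr_ge0// mulr_ge0 ?sqrtr_ge0// !mulr_ge0. Qed.

Let L_ge0 delta n r x : 0 < delta < 1 -> 0 <= x -> 0 < L delta n r x.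
Proof.
move=> /andP[d0 d1] x0; rewrite ltr_pwDl ?ln_gt0 ?invf_gt1//.
by rewrite ln_ge0// lerDl slope_ge0.
Qed.

Let L_homo delta n r x y : 0 <= x -> x <= y -> L delta n r x <= L delta n r y.
Proof.
move=> x0 xy; have y0 := le_trans x0 xy.
rewrite lerD2l ler_ln ?posrE ?ltr_pwDl ?slope_ge0// lerD2l.
by rewrite ler_wpM2r ?invr_ge0 ?sqrtr_ge0// ler_wpM2l ?sqrtr_ge0// ler_wpM2l ?mulr_ge0.
Qed.

Lemma lambdaDKW_ge0 k delta n r : 0 <= lambdaDKW k delta n r.
Proof. by case: k => [|k] //=; rewrite /Psi le_min ler01 sqrtr_ge0. Qed.

Lemma lambdaDKW_le1 k delta n r : lambdaDKW k delta n r <= 1.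
Proof. by case: k => [|k] //=; rewrite /Psi ge_min lexx. Qed.

Lemma lambdaDKW_gt0 k delta n r : (0 < n)%N -> (0 < r)%N -> 0 < delta < 1 ->
  0 < lambdaDKW k delta n r.
Proof.
move=> n0 r0 dlt; case: k => [|k] /=; first exact: ltr01.
rewrite /Psi lt_min ltr01 sqrtr_gt0 divr_gt0//.
  exact: (L_ge0 n r dlt (lambdaDKW_ge0 k delta n r)).
by rewrite mulr_gt0// tau_gt0.
Qed.

Let lambdaDKW_nonincreasing k delta n r :
  lambdaDKW k.+1 delta n r <= lambdaDKW k delta n r.
Proof.
elim: k => [|k IH]; first by rewrite /= /Psi ge_min lexx.
have := L_homo delta n r (lambdaDKW_ge0 k.+1 delta n r) IH.
move=> h; rewrite [leLHS]/= [leRHS]/= /Psi le_min ge_min lexx/= ge_min.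
by rewrite ler_wsqrtr ?orbT// ler_wpM2r// invr_ge0 mulr_ge0.
Qed.

(** When the minimum in [Psi] is not 1, [2 * tau * x ^+ 2] equals [L] at the previous iterate. That
    iterate is at least [x] and [L] is nondecreasing, so the exponential is at most [expR (- L x)],
    which is [delta] over the prefactor. *)
Lemma lambdaDKW_bound k delta n r : (0 < n)%N -> (0 < r)%N -> 0 < delta < 1 ->
  lambdaDKW k delta n r = 1 \/ dkw_bound n r (lambdaDKW k delta n r) <= delta.
Proof.
move=> n0 r0 dlt; case: k => [|k]; first by left.
set x := lambdaDKW k.+1 delta n r; have [x1|x1] := leP 1 x.
  by left; apply/eqP; rewrite eq_le x1 lambdaDKW_le1.
right; have x0 : 0 <= x by exact: lambdaDKW_ge0.
have Lx0 : 0 < L delta n r (lambdaDKW k delta n r).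
  exact: (L_ge0 n r dlt (lambdaDKW_ge0 k delta n r)).
have T0 : 0 < tau n r :> R by exact: tau_gt0.
have xE : 2 * tau n r * x ^+ 2 = L delta n r (lambdaDKW k delta n r).
  have -> : x = Num.sqrt (L delta n r (lambdaDKW k delta n r) / (2 * tau n r)).
    move: x1; rewrite /x /= /Psi -/(lambdaDKW k delta n r) -/(L _ _ _ _).
    by rewrite /Order.min; case: ifP => //; rewrite ltxx.
  rewrite sqr_sqrtr ?divr_ge0 ?(ltW Lx0)//; first by field; rewrite gt_eqF.
  by rewrite mulr_ge0// ltW.
rewrite /dkw_bound xE.
have Lle : L delta n r x <= L delta n r (lambdaDKW k delta n r).
  by apply: L_homo => //; exact: lambdaDKW_nonincreasing.
have s0 := slope_ge0 n r x0; set u := _ / Num.sqrt _ in s0 *.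
have u0 : 0 < 1 + u by rewrite ltr_pwDl.
apply: (@le_trans _ _ ((1 + u) * expR (- L delta n r x))).
  by rewrite ler_wpM2l ?(ltW u0)// ler_expR lerN2.
case/andP: dlt => d0 d1.
rewrite /L -/u opprD expRD !expRN !lnK ?posrE ?invr_gt0// invrK mulrC -mulrA mulVf ?mulr1//.
by rewrite gt_eqF.
Qed.

Let ln_dilation (c u : R) : 1 <= c -> 0 <= u -> ln (1 + u) <= c * ln (1 + u / c).
Proof.
move=> c1 u0; have c0 : 0 < c by exact: lt_le_trans c1.
pose F (x : R) : R := c * ln (1 + x / c) - ln (1 + x).
have dF (x : R) : 0 <= x -> is_derive x 1 F ((1 + x / c)^-1 - (1 + x)^-1).
  move=> x0; have xc0 : 0 < 1 + x / c by rewrite ltr_pwDl// divr_ge0// ltW.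
  have x10 : 0 < 1 + x by rewrite ltr_pwDl.
  have d1 : is_derive x 1 (fun x : R => 1 + x / c) c^-1.
    by apply: is_derive_eq; rewrite /GRing.scale/=; lra.
  have d2 : is_derive x 1 (fun x : R => 1 + x) 1.
    by apply: is_derive_eq; lra.
  have dl1 := @is_derive1_comp _ (@ln R) _ x _ _ (is_derive1_ln xc0) d1.
  have dl2 := @is_derive1_comp _ (@ln R) _ x _ _ (is_derive1_ln x10) d2.
  rewrite /F; apply: is_derive_eq; rewrite /GRing.scale/= mulr1.
  by congr (_ - _); rewrite mulrC -mulrA mulVf ?mulr1// gt_eqF.
have : F 0 <= F u.
  apply: (is_derive_ge0_le u0 (fun x xu => dF x (proj1 (andP xu)))) => x /andP[x0 _].
  rewrite subr_ge0 lef_pV2 ?posrE ?ltr_pwDl ?divr_ge0 ?(ltW x0) ?(ltW c0)//.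
  by rewrite lerD2l ler_pdivrMr// ler_peMr// ltW.
by rewrite /F mul0r !addr0 ln1 mulr0 subr0 subr_ge0.
Qed.

(* The prefactor [r (n + r)] grows fast enough to compensate the decay of the
   logarithm in [(n + r)^(3/2)]. *)
Let scaled_ln_le (a r s y z D : R) : 0 < a -> 0 < r -> r <= s -> 0 <= y -> y <= z -> 0 <= D ->
  r * (a + r) * ln (1 + D * y / ((a + r) * Num.sqrt (a + r))) <=
  s * (a + s) * ln (1 + D * z / ((a + s) * Num.sqrt (a + s))).
Proof.
move=> a0 r0 rs y0 yz D0.
have ar : 0 < a + r by rewrite addr_gt0.
have as_ : 0 < a + s by rewrite addr_gt0// (lt_le_trans r0).
have s0 : 0 < s by exact: lt_le_trans rs.
set p := Num.sqrt (a + r); set q := Num.sqrt (a + s).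
have p0 : 0 < p by rewrite sqrtr_gt0.
have q0 : 0 < q by rewrite sqrtr_gt0.
have pE : a + r = p ^+ 2 by rewrite sqr_sqrtr// ltW.
have qE : a + s = q ^+ 2 by rewrite sqr_sqrtr// ltW.
have pq : p <= q by rewrite ler_sqrt ?(ltW as_)// lerD2l.
have rqsp : r * q <= s * p.
  rewrite -(@ler_pXn2r _ 2) ?nnegrE ?mulr_ge0 ?(ltW r0) ?(ltW s0) ?(ltW p0) ?(ltW q0)//.
  rewrite !exprMn -pE -qE.
  have h1 : r ^+ 2 <= s ^+ 2 by rewrite ler_pXn2r ?nnegrE ?(ltW r0) ?(ltW s0).
  have h2 : a * r ^+ 2 <= a * s ^+ 2 by rewrite ler_wpM2l// ltW.
  have h3 : r * s * r <= r * s * s by rewrite ler_wpM2l// mulr_ge0// ltW.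
  lra.
(* The ratio of the two denominators [(a + s)^(3/2)] and [(a + r)^(3/2)]. After [ln_dilation] there
   remains [r * (a + r) * c <= s * (a + s)], which is [r * q <= s * p]. *)
pose c := (q / p) ^+ 3.
have qp1 : 1 <= q / p by rewrite ler_pdivlMr// mul1r.
have c1 : 1 <= c by rewrite exprn_ege1.
have u0 : 0 <= D * y / ((a + r) * p) by rewrite divr_ge0 ?mulr_ge0// ltW.
have w0 : 0 <= D * y / ((a + s) * q) by rewrite divr_ge0 ?mulr_ge0// ltW.
have := ln_dilation c1 u0.
have -> : D * y / ((a + r) * p) / c = D * y / ((a + s) * q).
  by rewrite /c pE qE; field; rewrite !gt_eqF.
have rar : 0 <= r * (a + r) by rewrite mulr_ge0// ltW.
move=> /(ler_wpM2l rar)/le_trans; apply; rewrite mulrA.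
apply: ler_pM.
- by rewrite mulr_ge0// (le_trans ler01).
- by rewrite ln_ge0// lerDl.
- have -> : r * (a + r) * c = r * q * (q ^+ 2 / p) by rewrite /c pE; field; rewrite gt_eqF.
  have -> : s * (a + s) = s * p * (q ^+ 2 / p) by rewrite qE; field; rewrite gt_eqF.
  by rewrite ler_wpM2r// divr_ge0 ?exprn_ge0// ltW.
- have zw : D * y / ((a + s) * q) <= D * z / ((a + s) * q).
    by rewrite ler_wpM2r ?invr_ge0 ?mulr_ge0 ?(ltW as_) ?(ltW q0)// ler_wpM2l.
  by rewrite ler_ln ?posrE ?ltr_pwDl// ?(le_trans w0 zw)// lerD2l.
Qed.

(** Since [tau] contains a factor [r], the square of [r * Psi x], apart from the minimum, depends on
    [x] only through [r * x]; so the induction runs on the product itself. *)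
Lemma scaled_lambdaDKW_le k delta n r s : (0 < n)%N -> (0 < r)%N -> (r <= s)%N ->
  0 < delta < 1 ->
  r%:R * lambdaDKW k delta n r <= s%:R * lambdaDKW k delta n s.
Proof.
move=> n0 r0 rs dlt; have s0 : (0 < s)%N by exact: leq_trans rs.
have nR : 0 < n%:R :> R by rewrite ltr0n.
have rR : 0 < r%:R :> R by rewrite ltr0n.
have sR : 0 < s%:R :> R by rewrite ltr0n.
have rsR : r%:R <= s%:R :> R by rewrite ler_nat.
elim: k => [|k IH]; first by rewrite /= !mulr1.
rewrite /= -!/(lambdaDKW k delta n _).
have := lambdaDKW_ge0 k delta n r; have := lambdaDKW_ge0 k delta n s.
move: IH; move: (lambdaDKW k delta n r) (lambdaDKW k delta n s) => x z IH z0 x0.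
have sqE (t : nat) (w : R) : (0 < t)%N -> 0 <= w -> t%:R * Num.sqrt (L delta n t w / (2 * tau n t)) =
   Num.sqrt ((2 * n%:R)^-1 * (t%:R * (n%:R + t%:R) * ln delta^-1 +
      t%:R * (n%:R + t%:R) * ln (1 + (2 * Num.sqrt (2 * pi) * n%:R) * (t%:R * w) /
         ((n%:R + t%:R) * Num.sqrt (n%:R + t%:R))))).
  move=> t0 w0; have tR : 0 < t%:R :> R by rewrite ltr0n.
  have ntR : 0 < n%:R + t%:R :> R by rewrite addr_gt0.
  have qR : 0 < Num.sqrt (n%:R + t%:R) :> R by rewrite sqrtr_gt0.
  rewrite -[t%:R in LHS]gtr0_norm// -sqrtr_sqr -sqrtrM ?sqr_ge0//; congr Num.sqrt.
  rewrite /L /tau natrM natrD.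
  have -> : Num.sqrt (2 * pi) * (2 * (n%:R * t%:R / (n%:R + t%:R)) * w) / Num.sqrt (n%:R + t%:R) =
     (2 * Num.sqrt (2 * pi) * n%:R) * (t%:R * w) / ((n%:R + t%:R) * Num.sqrt (n%:R + t%:R)) :> R.
    by field; rewrite !gt_eqF.
  by field; rewrite !gt_eqF.
have main : r%:R * Num.sqrt (L delta n r x / (2 * tau n r)) <=
    s%:R * Num.sqrt (L delta n s z / (2 * tau n s)).
  rewrite !sqE// ler_wsqrtr// ler_wpM2l ?invr_ge0 ?mulr_ge0//.
  apply: lerD.
    have ld : 0 <= ln delta^-1 by case/andP: dlt => d0 d1; rewrite ln_ge0// invf_ge1// ltW.
    by rewrite ler_wpM2r// ler_pM// ?addr_ge0// lerD2l.
  by apply: scaled_ln_le; rewrite ?mulr_ge0 ?sqrtr_ge0.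
rewrite /Psi -!/(L _ _ _ _) !minr_pMr ?(ltW rR) ?(ltW sR)// !mulr1.
by rewrite le_min !ge_min rsR main orbT.
Qed.

End iterated_radius.

(** * False discovery proportion *)

Section fdp_bound.
Variables (R : realType) (n m : nat) (Scal : 'I_n -> R) (Stest : 'I_m -> R).
Variables (H0 : {set 'I_m}) (k : nat) (delta : R).
Hypotheses (n0 : (0 < n)%N) (dlt : 0 < delta < 1).

Let p := conf_pval Scal Stest.
Let r := #|H0|.
Let lam := lambdaDKW k delta n r.
Let above (j : 'I_m) : nat := #|[set i : 'I_n | Stest j <= Scal i]%SET|.

Hypothesis ecdf_le : forall l : nat, (l <= n)%N ->
  (#|[set j in H0 | (above j < l)%N]%SET|)%:R <= r%:R * (l%:R / n.+1%:R + lam).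

(** [l] is the floor of [(n + 1) * t], at most [n] because [t < 1]; p-values are multiples of
    [1 / (n + 1)], so thresholds only matter through it. *)
Let In_level (t : R) : 0 < t < 1 -> exists l : nat,
  [/\ (l <= n)%N, In_ n t = l%:R / n.+1%:R & forall j, (p j <= t) = (above j < l)%N].
Proof.
move=> /andP[t0 t1]; have N0 : 0 < n.+1%:R :> R by rewrite ltr0n.
have nt0 : 0 <= n.+1%:R * t by rewrite mulr_ge0// ltW.
have f0 : 0 <= Num.floor (n.+1%:R * t) by rewrite floor_ge0.
exists `|Num.floor (n.+1%:R * t)|%N; split.
- rewrite -ltnS -ltz_nat gez0_abs// floor_lt_int.
  by rewrite gtr_pMr.
- by rewrite /In_ -[in LHS](gez0_abs f0).
- move=> j; rewrite /p /conf_pval ler_pdivrMr// mulrC.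
  rewrite -[(above j < _)%N]lez_nat gez0_abs// floor_ge_int.
  by rewrite add1n.
Qed.

Let null_rej_le (t : R) : 0 < t < 1 ->
  (#|rej p t :&: H0|)%:R <= r%:R * In_ n t + r%:R * lam.
Proof.
move=> /In_level[l [ln -> pE]]; rewrite -mulrDr; apply: le_trans (ecdf_le ln).
rewrite ler_nat; apply: subset_leq_card; apply/fintype.subsetP => j.
by rewrite !inE pE => /andP[-> ->].
Qed.

Let In_lt1 (t : R) : 0 < t < 1 -> In_ n t < 1 :> R.
Proof.
move=> /In_level[l [ln -> _]].
by rewrite ltr_pdivrMr ?ltr0n// mul1r ltr_nat ltnS.
Qed.

(** Every null is either rejected or counted in [p > t]. Bounding the rejected nulls by
    [r * In_ n t + r * lam] and dividing by [1 - In_ n t] gives the condition for each [t]. *)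
Let null_card_cond : (0 < r)%N -> m0_cond k delta n p r.
Proof.
move=> r0; rewrite /m0_cond r0/=; apply: lb_le_inf.
  (* [lb_le_inf] requires a nonempty set; any level in the unit interval would do. *)
  have h : 0 < (2^-1 : R) < 1 by apply/andP; split; lra.
  by exists (((#|[set i | (2^-1 : R) < p i]%SET|)%:R + r%:R * lambdaDKW k delta n r)
     / (1 - In_ n 2^-1)); exists 2^-1 => //=; rewrite in_itv/=.
move=> x [t]; rewrite /= in_itv/= => t01 <-.
rewrite ler_pdivlMr ?subr_gt0 ?In_lt1//.
have := null_rej_le t01.
have : r%:R <= (#|[set i | t < p i]%SET|)%:R + (#|rej p t :&: H0|)%:R :> R.
  rewrite -natrD ler_nat -[r](cardsID (rej p t)) addnC finset.setIC leq_add2r.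
  apply: subset_leq_card; apply/fintype.subsetP => j.
  by rewrite !inE -ltNge => /andP[].
rewrite -/lam mulrBr mulr1; lra.
Qed.

Lemma fdp_le_of_null_ecdf (m0 : nat) (t : R) :
  (m0_bound k delta n p <= m0)%N -> 0 < t < 1 ->
  FDP H0 (rej p t) <=
    (m0%:R * In_ n t + m0%:R * lambdaDKW k delta n m0) / (maxn 1 #|rej p t|)%:R.
Proof.
move=> m0le t01; rewrite /FDP maxnC ler_wpM2r ?invr_ge0//.
have It0 : 0 <= In_ n t :> R.
  by have [l [_ -> _]] := In_level t01; rewrite divr_ge0.
(* [m0_cond] excludes 0, so an empty [H0] is handled apart, with no false discovery. *)
have [r0|r0] := posnP r.
  rewrite (cards0_eq r0) finset.setI0 cards0.
  by rewrite addr_ge0// mulr_ge0// lambdaDKW_ge0.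
have rm0 : (r <= m0)%N.
  apply: leq_trans m0le; rewrite /m0_bound.
  have rm : (r < m.+1)%N by rewrite ltnS -[leqRHS]card_ord max_card.
  have cr : m0_cond k delta n p (Ordinal rm) by exact: null_card_cond.
  case: ifPn => [_|/existsPn/(_ (Ordinal rm))]; last by rewrite cr.
  exact: (@leq_bigmax_cond _ (fun i : 'I_m.+1 => m0_cond k delta n p i) (fun i => i) (Ordinal rm) cr).
apply: le_trans (null_rej_le t01) _; apply: lerD.
  by rewrite ler_wpM2r// ler_nat.
exact: scaled_lambdaDKW_le.
Qed.

End fdp_bound.

(** * Exchangeable conformal scores *)

Lemma perm_extension (X Y : finType) (emb : X -> Y) (p : {perm X}) : injective emb ->
  exists p1 : {perm Y}, (forall x, p1 (emb x) = emb (p x)) /\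
    forall y, (forall x, emb x <> y) -> p1 y = y.
Proof.
move=> emb_inj.
pose h y := if [pick x | emb x == y] is Some x then emb (p x) else y.
have hE x : h (emb x) = emb (p x).
  by rewrite /h; case: pickP => [x' /eqP/emb_inj->//|/(_ x)]; rewrite eqxx.
have hN y : (forall x, emb x <> y) -> h y = y.
  by move=> ny; rewrite /h; case: pickP => // x /eqP /ny.
have h_inj : injective h.
  have dec y : (exists x, y = emb x) \/ (forall x, emb x <> y).
    by have [[x ->]|ny] := pselect (exists x, y = emb x); [left; exists x|right => x xy; apply: ny; exists x].
  move=> y y'; have [[x ->]|ny] := dec y; have [[x' ->]|ny'] := dec y'.
  - by rewrite !hE => /emb_inj/perm_inj ->.
  - by rewrite hE (hN _ ny') => xy; case: (ny' _ xy).
  - by rewrite hE (hN _ ny) => xy; case: (ny (p x')).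
  - by rewrite !hN.
by exists (perm h_inj); split => [x|y ny]; rewrite permE ?hE ?hN.
Qed.

Section conformal_scores.
Context {R : realType} {dT dE : measure_display} {T : measurableType dT} {E : measurableType dE}.
Variables (P : probability T R) (P0 : probability E R) (q n m : nat).
Variables (Xtr : 'I_q -> T -> E) (Xcal : 'I_n -> T -> E) (Xtest : 'I_m -> T -> E).
Variables (H0 : {set 'I_m}) (g : E -> q.-tuple E -> (n + m).-tuple E -> R).

Let K := ('I_q + 'I_n + 'I_m)%type.
Let Z (k : K) : T -> E :=
  match k with
  | inl (inl i) => Xtr i
  | inl (inr j) => Xcal j
  | inr i => Xtest i
  end.

Hypothesis mXtr : forall i, measurable_fun setT (Xtr i).
Hypothesis mXcal : forall j, measurable_fun setT (Xcal j).
Hypothesis mXtest : forall i, measurable_fun setT (Xtest i).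
Hypothesis indZ : mutual_indep P Z.
Hypothesis lawXcal : forall j, has_law P (Xcal j) P0.
Hypothesis lawXtest : forall i, i \in H0 -> has_law P (Xtest i) P0.
Hypothesis mg : measurable_fun setT
  (fun z : E * (q.-tuple E * (n + m).-tuple E) => g z.1 z.2.1 z.2.2).
Hypothesis g_sym : forall (s : {perm 'I_(n + m)}) x tr (xs : (n + m).-tuple E),
  g x tr [tuple tnth xs (s i) | i < n + m] = g x tr xs.

Definition conformal_score (w : T) (x : 'I_(n + m)) : R :=
  let data := cat_tuple [tuple Xcal j w | j < n] [tuple Xtest i w | i < m] in
  g (tnth data x) [tuple Xtr i w | i < q] data.

Let S := conformal_score.
Let up (y : 'I_n + 'I_m) : K :=
  match y with inl j => inl (inr j) | inr i => inr i end.
Let ix (x : 'I_(n + m)) : K := up (fintype.split x).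
Let V := #|{: K}|.-tuple E.
Let zc (z : V) (k : K) : E := tnth z (enum_rank k).
Let trz (z : V) : q.-tuple E := [tuple zc z (inl (inl i)) | i < q].
Let daz (z : V) : (n + m).-tuple E := [tuple zc z (ix x) | x < n + m].
Let Sz (z : V) (x : 'I_(n + m)) : R := g (zc z (ix x)) (trz z) (daz z).
Let Y (k : {perm K}) (w : T) : V := [tuple Z (k (enum_val i)) w | i < #|{: K}|].

Let zcY k w i : zc (Y k w) i = Z (k i) w.
Proof. by rewrite /zc /Y tnth_mktuple enum_rankK. Qed.

Let mZ k : measurable_fun setT (Z k).
Proof. by case: k => [[i|j]|i] /=. Qed.

Let mSz x : measurable_fun setT (Sz ^~ x).
Proof.
have mzc k : measurable_fun setT (zc ^~ k) by exact: measurable_tnth.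
have mt : measurable_fun setT (fun z : V => (zc z (ix x), (trz z, daz z))).
  apply: measurable_fun_pair => //; apply: measurable_fun_pair.
    apply/measurable_fun_tnthP => i.
    rewrite [X in measurable_fun _ X](_ : _ = zc ^~ (inl (inl i)))//.
    by apply/funext => z /=; rewrite tnth_mktuple.
  apply/measurable_fun_tnthP => i.
  rewrite [X in measurable_fun _ X](_ : _ = zc ^~ (ix i))//.
  by apply/funext => z /=; rewrite tnth_mktuple.
exact: (measurableT_comp mg mt).
Qed.

Let mY k : measurable_fun setT (Y k).
Proof.
apply/measurable_fun_tnthP => i.
rewrite [X in measurable_fun _ X](_ : _ = Z (k (enum_val i)))//.
by apply/funext => w /=; rewrite tnth_mktuple.
Qed.

Let dataE w : cat_tuple [tuple Xcal j w | j < n] [tuple Xtest i w | i < m] =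
  [tuple Z (ix x) w | x < n + m].
Proof.
apply: eq_from_tnth => x; rewrite [in RHS]tnth_mktuple /ix.
case: (split_ordP x) => [j ->|i ->].
  by rewrite tnth_lshift tnth_mktuple.
by rewrite tnth_rshift tnth_mktuple.
Qed.

Let SzY w x : Sz (Y 1 w) x = S w x.
Proof.
rewrite /Sz /S /conformal_score dataE tnth_mktuple zcY perm1; congr g.
  by apply: eq_from_tnth => i; rewrite !tnth_mktuple zcY perm1.
by apply: eq_from_tnth => i; rewrite !tnth_mktuple zcY perm1.
Qed.

Let mS x : measurable_fun setT (S ^~ x).
Proof.
have -> : S ^~ x = (Sz ^~ x) \o Y 1 by apply/funext => w /=; rewrite SzY.
exact: measurableT_comp.
Qed.

Let J := {i : 'I_m | i \in H0}.
Let X := ('I_n + J)%type.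
Let emb (x : X) : 'I_n + 'I_m := match x with inl i => inl i | inr j => inr (val j) end.
Let lidx (x : X) : 'I_(n + m) := unsplit (emb x).

Let emb_inj : injective emb.
Proof. by move=> [i|j] [i'|j'] //= [] => [->|/val_inj ->]. Qed.

Let lidx_inj : injective lidx.
Proof. by move=> x y /(can_inj (@fintype.unsplitK n m))/emb_inj. Qed.

(** Only calibration and null test points move, and all of them have law [P0]; hence [k] preserves
    every marginal law. *)
Let lift_perm (p : {perm X}) : exists (pi : {perm 'I_(n + m)}) (k : {perm K}),
  [/\ forall x, pi (lidx x) = lidx (p x), forall i, k (inl (inl i)) = inl (inl i),
      forall x, k (ix x) = ix (pi x) &
      forall i B, measurable B -> P (Z (k i) @^-1` B) = P (Z i @^-1` B)].
Proof.
have [p1 [p1E p1N]] := perm_extension p emb_inj.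
have pi_inj : injective (fun x : 'I_(n + m) => unsplit (p1 (fintype.split x))).
  by move=> x y /(can_inj (@fintype.unsplitK n m))/perm_inj/(can_inj (@fintype.splitK n m)).
pose kf (k : K) : K := match k with
  | inl (inl i) => inl (inl i)
  | inl (inr j) => up (p1 (inl j))
  | inr i => up (p1 (inr i)) end.
have up_inj : injective up by move=> [i|i] [j|j] // [->].
have kf_up y : kf (up y) = up (p1 y) by case: y.
have upN y i : up y <> inl (inl i) by case: y.
have kf_inj : injective kf.
  have dec k : (exists y, k = up y) \/ (exists i, k = inl (inl i)).
    by case: k => [[i|j]|i]; [right; exists i|left; exists (inl j)|left; exists (inr i)].
  move=> k k'; have [[y ->]|[i ->]] := dec k; have [[y' ->]|[i' ->]] := dec k'.
  - by rewrite !kf_up => /up_inj/perm_inj ->.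
  - by rewrite kf_up => /upN.
  - by rewrite kf_up => /esym/upN.
  - by [].
exists (perm pi_inj), (perm kf_inj); split.
- by move=> x; rewrite permE /lidx unsplitK p1E.
- by move=> i; rewrite permE.
- by move=> x; rewrite !permE /ix kf_up unsplitK.
move=> k B mB; rewrite permE.
case: k => [[i//|j]|i] /=.
  have -> : p1 (inl j) = emb (p (inl j)) by rewrite -p1E.
  rewrite (lawXcal j mB); case: (p (inl j)) => [j'|[i' i'H]] /=.
    exact: lawXcal.
  exact: lawXtest.
have [iH|iH] := boolP (i \in H0); last first.
  rewrite p1N// => -[//|[i' i'H]] /= [ii']; move: iH; rewrite -ii' i'H//.
have -> : p1 (inr i) = emb (p (inr (exist _ i iH))) by rewrite -p1E.
rewrite (lawXtest iH mB); case: (p _) => [j'|[i' i'H]] /=.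
  exact: lawXcal.
exact: lawXtest.
Qed.

Variable l : R.
Hypotheses (n0 : (0 < n)%N) (H0n0 : (0 < #|H0|)%N) (l0 : 0 < l).

Let inj_pattern (c : {ffun 'I_(n + m) * 'I_(n + m) -> bool}) :=
  [forall x, forall y, c (x, y) && c (y, x) ==> (x == y)].
Let exc_pattern (c : {ffun 'I_(n + m) * 'I_(n + m) -> bool}) :=
  ecdf_exceeds l (fun (i : 'I_n) (j : J) => c (rshift n (val j), lshift m i)).
Let pattern (s : 'I_(n + m) -> R) : {ffun 'I_(n + m) * 'I_(n + m) -> bool} :=
  [ffun c => s c.1 <= s c.2].

Let inj_patternP (s : 'I_(n + m) -> R) : reflect (injective s) (inj_pattern (pattern s)).
Proof.
apply: (iffP forallP) => [h x y sxy|si x].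
  by have /forallP/(_ y) := h x; rewrite !ffunE/= sxy lexx => /eqP.
by apply/forallP => y; apply/implyP; rewrite !ffunE/= -eq_le => /eqP/si ->.
Qed.

(** Absence of ties holds only almost surely; including it in the event makes the permutation count
    valid at every [w]. *)
Let bad (z : V) : bool := inj_pattern (pattern (Sz z)) && exc_pattern (pattern (Sz z)).

Let mbad : measurable [set z | bad z].
Proof.
exact: (measurable_order_pattern (fun c => inj_pattern c && exc_pattern c) mSz).
Qed.

(** Permuting the data leaves the score function unchanged by [g_sym], so it merely permutes the
    scores. *)
Let SzY_perm (pi : {perm 'I_(n + m)}) (k : {perm K}) w :
  (forall i, k (inl (inl i)) = inl (inl i)) -> (forall x, k (ix x) = ix (pi x)) ->
  forall x, Sz (Y k w) x = S w (pi x).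
Proof.
move=> ktr kix x.
rewrite /Sz /S /conformal_score dataE tnth_mktuple zcY kix -[RHS](g_sym pi); congr g.
  by apply: eq_from_tnth => i; rewrite !tnth_mktuple zcY ktr.
by apply: eq_from_tnth => i; rewrite !tnth_mktuple zcY kix.
Qed.

Let dkw_ge0 : 0 <= dkw_bound n #|H0| l.
Proof.
rewrite mulr_ge0 ?expR_ge0// addr_ge0// divr_ge0 ?sqrtr_ge0//.
by rewrite mulr_ge0 ?sqrtr_ge0// !mulr_ge0 ?divr_ge0// ltW.
Qed.

(** All permuted data vectors have the same law, so the probability is an average over permutations,
    bounded pointwise by [card_perm_ecdf_exceeds]. *)
Let P_bad : (P [set w | bad (Y 1 w)] <= (dkw_bound n #|H0| l)%:E)%E.
Proof.
pose D := dkw_bound n #|H0| l.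
have cJ : #|{: J}| = #|H0| by rewrite card_sig; apply: eq_card.
pose kp (p : {perm X}) : {perm K} := projT1 (cid (projT2 (cid (lift_perm p)))).
pose pip (p : {perm X}) : {perm 'I_(n + m)} := projT1 (cid (lift_perm p)).
have kpP p : [/\ forall x, pip p (lidx x) = lidx (p x), forall i, kp p (inl (inl i)) = inl (inl i),
      forall x, kp p (ix x) = ix (pip p x) &
      forall i B, measurable B -> P (Z (kp p i) @^-1` B) = P (Z i @^-1` B)].
  exact: (projT2 (cid (projT2 (cid (lift_perm p))))).
have PE p : P [set w | bad (Y (kp p) w)] = P [set w | bad (Y 1 w)].
  have [_ _ _ lawk] := kpP p.
  have e := mutual_indep_perm mZ indZ lawk mbad.
  have e1 : P ((fun w => [tuple Z (enum_val i) w | i < #|{: K}|]) @^-1` [set z | bad z]) =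
      P [set w | bad (Y 1 w)].
    congr (P _); apply/seteqP; split => w /=; congr (is_true (bad _));
      by apply: eq_from_tnth => i; rewrite !tnth_mktuple perm1.
  by rewrite -e1 -e.
have card_bad w : (#|[set p | `[< bad (Y (kp p) w) >]]%SET|)%:R <= (#|{: X}|)`!%:R * D.
  (* One bad permutation at [w] already forces the scores at [w] to be distinct; without one the
     count is 0. *)
  have [[p0 bad0]|nobad] := pselect (exists p, bad (Y (kp p) w)); last first.
    suff -> : [set p | `[< bad (Y (kp p) w) >]]%SET = finset.set0.
      by rewrite cards0 mulr_ge0.
    by apply/setP => p; rewrite !inE; apply/asboolP => bp; apply: nobad; exists p.
  have S_inj : injective (S w).
    have [_ ktr kix _] := kpP p0.
    case/andP: bad0 => /inj_patternP si _ x y.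
    rewrite -[x](permKV (pip p0)) -[y](permKV (pip p0)) -!(SzY_perm w ktr kix).
    by move=> /si ->.
  have s_inj : injective (fun x : X => S w (lidx x)).
    by move=> x y /S_inj/lidx_inj.
  have I0 : (0 < #|'I_n|)%N by rewrite card_ord.
  have J0 : (0 < #|{: J}|)%N by rewrite cJ.
  have := card_perm_ecdf_exceeds I0 J0 l0 s_inj; rewrite card_ord cJ; apply: le_trans.
  rewrite ler_nat; apply: subset_leq_card; apply/fintype.subsetP => p.
  rewrite !inE => badp; have [pE ktr kix _] := kpP p.
  case/andP: badp => _ exc.
  suff e : (fun (i : 'I_n) (j : J) =>
      pattern (Sz (Y (kp p) w)) (rshift n (val j), lshift m i)) =
    (fun i j => S w (lidx (p (inr j))) <= S w (lidx (p (inl i)))).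
    by rewrite /exc_pattern e in exc.
  apply/funext => i; apply/funext => j; rewrite ffunE /= !(SzY_perm w ktr kix).
  by rewrite -[lshift m i]/(lidx (inl i)) -[rshift n _]/(lidx (inr j)) !pE.
have mb p : measurable [set w | bad (Y (kp p) w)].
  by rewrite -[X in measurable X]setTI; exact: (mY (kp p) measurableT mbad).
have := sum_probability_le P mb card_bad.
under eq_bigr do rewrite PE.
have Pfin : P [set w | bad (Y 1 w)] \is a fin_num.
  by apply: fin_num_measure; rewrite -[X in measurable X]setTI; exact: (mY 1 measurableT mbad).
rewrite -(fineK Pfin) sumEFin sumr_const !lee_fin.
have -> : #|{perm X}| = (#|{: X}|)`!.
  rewrite -[in RHS]cardsT -card_perm; apply: eq_card => p; rewrite !inE.
  by apply/esym/fintype.subsetP => x _; rewrite inE.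
by rewrite -[fine _ *+ _]mulr_natl ler_pM2l// ltr0n fact_gt0.
Qed.

Lemma conformal_ecdf_bound : {ae P, forall w, injective (conformal_score w)} ->
  exists A : set T, measurable A /\ ((1 - dkw_bound n #|H0| l)%:E <= P A)%E /\
    forall w, A w -> ~~ ecdf_exceeds l (fun (i : 'I_n) (j : {i : 'I_m | i \in H0}) =>
      conformal_score w (rshift n (val j)) <= conformal_score w (lshift m i)).
Proof.
move=> ae_inj.
pose A := [set w | ~~ exc_pattern (pattern (S w))].
have mA : measurable A.
  exact: (measurable_order_pattern (fun c => ~~ exc_pattern c) mS).
exists A; split => //; split; last first.
  move=> w; rewrite /A/= /exc_pattern.
  suff -> : (fun (i : 'I_n) (j : J) => pattern (S w) (rshift n (val j), lshift m i)) =
    (fun i j => S w (rshift n (val j)) <= S w (lshift m i)) by [].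
  by apply/funext => i; apply/funext => j; rewrite ffunE.
pose N := [set w | ~~ inj_pattern (pattern (S w))].
have mN : measurable N.
  exact: (measurable_order_pattern (fun c => ~~ inj_pattern c) mS).
have PN : P N = 0%E.
  apply/negligibleP => //; move: ae_inj; apply: negligibleS => w /= Nw inj.
  by move: Nw => /negP; apply; apply/inj_patternP.
have PA : (P (~` A) <= (dkw_bound n #|H0| l)%:E)%E.
  apply: (@le_trans _ _ (P ([set w | bad (Y 1 w)] `|` N))).
    apply: le_measure; rewrite ?inE.
    - exact: measurableC.
    - apply: measurableU => //.
      by rewrite -[X in measurable X]setTI; exact: (mY 1 measurableT mbad).
    - move=> w /= /negP; rewrite negbK => exc.
      have [inj|ninj] := boolP (inj_pattern (pattern (S w))); last by right.
      left; rewrite /bad; have -> : Sz (Y 1 w) = S w by apply/funext => x; rewrite SzY.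
      by rewrite inj.
  have mb : measurable [set w | bad (Y 1 w)].
    by rewrite -[X in measurable X]setTI; exact: (mY 1 measurableT mbad).
  apply: le_trans (measureU2 _ mb mN) _.
  by rewrite [X in (_ + X <= _)%E]PN adde0.
have -> : P A = (1 - P (~` A))%E.
  by rewrite -probability_setC ?setCK//; exact: measurableC.
by rewrite EFinB leeB.
Qed.

End conformal_scores.

Theorem corollary2
  (R : realType) (d : nat)
  (dT : measure_display) (T : measurableType dT) (P : probability T R)
  (P0 : probability (Rd R d) R)
  (n0 n m : nat) (hn1 : (1 < n)%N) (hnn0 : (n < n0)%N)
  (Xtr : 'I_(n0 - n) -> T -> Rd R d)   (* D_train *)
  (Xcal : 'I_n -> T -> Rd R d)         (* D_cal = (X_1,...,X_n) *)
  (Xtest : 'I_m -> T -> Rd R d)        (* D_test = (X_{n+1},...,X_{n+m}) *)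
  (H0 : {set 'I_m})
  (g : Rd R d -> (n0 - n).-tuple (Rd R d) -> (n + m).-tuple (Rd R d) -> R)
  (k : nat) (hk : (0 < k)%N)
  (delta : R) (hdelta : 0 < delta < 1)
  (m0hat : T -> nat) :
  (* measurability of the data *)
  (forall i, measurable_fun setT (Xtr i)) ->
  (forall j, measurable_fun setT (Xcal j)) ->
  (forall i, measurable_fun setT (Xtest i)) ->
  (* all n0 + m points are mutually independent *)
  mutual_indep P (fun s : ('I_(n0 - n) + 'I_n + 'I_m)%type =>
                    match s with
                    | inl (inl i) => Xtr i
                    | inl (inr j) => Xcal j
                    | inr i => Xtest i
                    end) ->
  (* D_null is i.i.d. from P0 *)
  (forall i, has_law P (Xtr i) P0) ->
  (forall j, has_law P (Xcal j) P0) ->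
  (* H0 = null test points *)
  (forall i, i \in H0 <-> has_law P (Xtest i) P0) ->
  (* the score function is measurable and permutation invariant in the data *)
  measurable_fun setT (fun z : Rd R d * ((n0 - n).-tuple (Rd R d) * (n + m).-tuple (Rd R d)) =>
                         g z.1 z.2.1 z.2.2) ->
  (forall (s : {perm 'I_(n + m)}) x tr (xs : (n + m).-tuple (Rd R d)),
      g x tr [tuple tnth xs (s i) | i < n + m] = g x tr xs) ->
  let train w := [tuple Xtr i w | i < n0 - n] in
  let data w := cat_tuple [tuple Xcal j w | j < n] [tuple Xtest i w | i < m] in
  let S w (l : 'I_(n + m)) := g (tnth (data w) l) (train w) (data w) in
  let Scal w (j : 'I_n) := S w (lshift m j) in
  let Stest w (i : 'I_m) := S w (rshift n i) in
  let p w := conf_pval (Scal w) (Stest w) in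
  (* almost surely no ties among the scores *)
  {ae P, forall w, injective (S w)} ->
  (* m0hat dominates the estimator bound *)
  (forall w, (m0_bound k delta n (p w) <= m0hat w)%N) ->
  exists E : set T, measurable E /\ ((1 - delta)%:E <= P E)%E /\
    forall w, E w -> forall t : R, 0 < t < 1 ->
      FDP H0 (rej (p w) t) <=
        ((m0hat w)%:R * In_ n t + (m0hat w)%:R * lambdaDKW k delta n (m0hat w))
        / (maxn 1 #|rej (p w) t|)%:R.
Proof.
move=> mXtr mXcal mXtest ind _ lawcal lawtest mg g_sym train data S Scal Stest p ae_inj m0le.
have n0_gt0 : (0 < n)%N by exact: ltnW.
set r := #|H0|; set lam := lambdaDKW k delta n r.
suff [A [mA [PA hA]]] : exists A : set T, measurable A /\ ((1 - delta)%:E <= P A)%E /\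
    forall w, A w -> forall l : nat, (l <= n)%N ->
      (#|[set j in H0 | (#|[set i | (Stest w j <= Scal w i)%R]%SET| < l)%N]%SET|)%:R <=
      r%:R * (l%:R / n.+1%:R + lam).
  exists A; split => //; split => // w Aw t t01.
  exact: (fdp_le_of_null_ecdf n0_gt0 hdelta (hA w Aw) (m0le w) t01).
have [d0 d1] : 0 < delta /\ delta < 1 by apply/andP.
have count_le_r w l :
    (#|[set j in H0 | (#|[set i | (Stest w j <= Scal w i)%R]%SET| < l)%N]%SET|)%:R <= r%:R :> R.
  by rewrite ler_nat; apply: subset_leq_card; apply/fintype.subsetP => j; rewrite inE => /andP[].
(* With no nulls, or with radius 1, the right side is at least [r] and the bound holds surely. *)
have trivial_case : (r == 0)%N \/ lam = 1 -> exists A : set T, measurable A /\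
    ((1 - delta)%:E <= P A)%E /\ forall w, A w -> forall l : nat, (l <= n)%N ->
      (#|[set j in H0 | (#|[set i | (Stest w j <= Scal w i)%R]%SET| < l)%N]%SET|)%:R <=
      r%:R * (l%:R / n.+1%:R + lam).
  move=> triv; exists setT; split => //; split.
    by rewrite probability_setT lee_fin gerBl ltW.
  move=> w _ l _; apply: le_trans (count_le_r w l) _.
  case: triv => [/eqP->|->]; first by rewrite mul0r.
  by rewrite ler_peMr// lerDr divr_ge0.
have [r0|r0] := posnP r; first by apply: trivial_case; left; rewrite r0.
have [lam1|dkw] := lambdaDKW_bound k n0_gt0 r0 hdelta.
  by apply: trivial_case; right.
have lam0 : 0 < lam by exact: lambdaDKW_gt0.
have lawtest' i : i \in H0 -> has_law P (Xtest i) P0 by move=> /lawtest.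
have [A [mA [PA hA]]] := conformal_ecdf_bound mXtr mXcal mXtest ind lawcal lawtest' mg g_sym
  n0_gt0 r0 lam0 ae_inj.
exists A; split => //; split.
  by apply: le_trans PA; rewrite lee_fin lerB.
move=> w Aw l ln.
have cJ : #|{: {i | i \in H0}}| = r by rewrite card_sig; apply: eq_card.
have ln' : (l < #|'I_n|.+1)%N by rewrite card_ord.
have /existsPn/(_ (Ordinal ln')) := hA w Aw; rewrite -leNgt /= card_ord cJ; apply: le_trans.
rewrite ler_nat.
pose B := [set j : {i | i \in H0} | (#|[set i | (Stest w (val j) <= Scal w i)%R]%SET| < l)%N]%SET.
rewrite -(card_imset B val_inj) ; apply: subset_leq_card; apply/fintype.subsetP => j.
rewrite inE => /andP[jH jl]; apply/imsetP; exists (exist _ j jH) => //.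
by rewrite inE.
Qed.
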